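(* Let $K\subset H$ be a Frobenius extension of Hopf algebras of right integral type over a field $\Bbbk$. Then $$\mathrm{Ind}_K^H\colon K\text{-}\mathbf{Mod}\to H\text{-}\mathbf{Mod}$$ is a Frobenius monoidal functor. This functor restricts to a functor between the categories of finite-dimensional modules, $\mathrm{Ind}_K^H\colon K\text{-}\mathbf{mod}\to H\text{-}\mathbf{mod}$.
   Context: All Hopf algebras are over $\Bbbk$ and have invertible antipode; $\Delta(h)=h_{(1)}\otimes h_{(2)}$ is the coproduct, $\varepsilon$ the counit. $H\text{-}\mathbf{Mod}$ is the monoidal category of left $H$-modules, $H\text{-}\mathbf{mod}$ its full subcategory of finite-dimensional modules. An extension $K\subset H$ is an inclusion of Hopf algebras. $\mathrm{Ind}_K^H(V)=H\otimes_K V$. Frobenius extension: $K\subset H$ is a Frobenius extension if $H$ is finitely generated projective over $K$ and there is a Frobenius morphism, i.e. a $K$-$K$-bimodule map $\mathrm{tr}\colon H\to K$ such that $H\to \mathrm{Hom}_K(H,K)$ (left $K$-linear maps), $h\mapsto \mathrm{tr}((-)h)$, is bijective. Given $\mathrm{tr}$ there are $h_1,\dots,h_n,\delta_1,\dots,\delta_n\in H$ with $h=\sum_i\mathrm{tr}(h\delta_i)h_i=\sum_i\delta_i\,\mathrm{tr}(h_ih)$ for all $h\in H$. Then $F=\mathrm{Ind}_K^H$ carries the lax and oplax monoidal structures $\mathrm{lax}_{V,U}\colon F(V)\otimes F(U)\to F(V\otimes U)$, $(h\otimes_K v)\otimes(g\otimes_K u)\mapsto\sum_i\delta_i\otimes_K(\mathrm{tr}((h_i)_{(1)}h)v\otimes\mathrm{tr}((h_i)_{(2)}g)u)$;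 $\mathrm{lax}_0\colon\Bbbk\to F(\Bbbk)$, $1\mapsto\sum_i\delta_i\otimes_K\varepsilon(h_i)$; $\mathrm{oplax}_{V,U}\colon F(V\otimes U)\to F(V)\otimes F(U)$, $h\otimes_K(v\otimes u)\mapsto(h_{(1)}\otimes_K v)\otimes(h_{(2)}\otimes_K u)$; $\mathrm{oplax}_0\colon F(\Bbbk)\to\Bbbk$, $h\otimes_K1\mapsto\varepsilon(h)$. Frobenius monoidal functor: a functor $F$ between monoidal categories with a lax and an oplax monoidal structure such that for all objects $X,Y,Z$: $(\mathrm{lax}_{X,Y}\otimes\mathrm{id})(\mathrm{id}\otimes\mathrm{oplax}_{Y,Z})=\mathrm{oplax}_{X\otimes Y,Z}\,\mathrm{lax}_{X,Y\otimes Z}$ and $(\mathrm{id}\otimes\mathrm{lax}_{Y,Z})(\mathrm{oplax}_{X,Y}\otimes\mathrm{id})=\mathrm{oplax}_{X,Y\otimes Z}\,\mathrm{lax}_{X\otimes Y,Z}$. The assertion that $\mathrm{Ind}_K^H$ is Frobenius monoidal refers to the structures above for a suitable Frobenius morphism $\mathrm{tr}$. Right integral type: Put $K^+=\ker\varepsilon_K$, $\overline H=H/HK^+$, $\overline h=h+HK^+$. $\overline H^*=\mathrm{Hom}_\Bbbk(\overline H,\Bbbk)$ is an algebra under convolution $(\mu*\nu)(\overline h)=\mu(\overline{h_{(1)}})\nu(\overline{h_{(2)}})$ with augmentation $\mu\mapsto\mu(\overline1)$. A right integral of an algebra $A$ with augmentation $\varepsilon$ is $\Lambda\in A$ with $\Lambda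 x=\Lambda\varepsilon(x)$ for all $x$. The extension $K\subset H$ is of right integral type if there exist (a) a non-zero right integral $\lambda$ of $\overline H^*$; (b) $\Lambda\in H$ with $\lambda(\overline{\Lambda h})=\varepsilon(h)$ for all $h\in H$; (c) an algebra map $\chi\colon K\to\Bbbk$ with $\lambda(\overline{kh})=\chi(k)\lambda(\overline h)$ for all $k\in K,h\in H$. *)

(* Defs.v *)
From HB Require Import structures.
From mathcomp Require Import all_boot all_order all_algebra.
From mathcomp Require Import boolp.

Set Implicit Arguments.
Unset Strict Implicit.
Unset Printing Implicit Defensive.

Import GRing.Theory.
Local Open Scope ring_scope.
Local Open Scope quotient_scope.

(* [tens ra la] is the tensor product over R of the right R-module M (action
   [ra]) and the left R-module N (action [la]).  It is the commutative monoid
   of finite formal sums of pairs (lists up to permutation), modulo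
   biadditivity and R-balancedness; additive inverses then come for free, with
   -(m, n) = (-m, n). *)
Section BalancedTensor.
Variables (M N : zmodType) (R : Type) (ra : M -> R -> M) (la : R -> N -> N).

Inductive tens_rel : seq (M * N) -> seq (M * N) -> Prop :=
| tens_rel_refl s : tens_rel s s
| tens_rel_sym s t : tens_rel s t -> tens_rel t s
| tens_rel_trans s t u : tens_rel s t -> tens_rel t u -> tens_rel s u
| tens_rel_cat s s' t t' :
    tens_rel s s' -> tens_rel t t' -> tens_rel (s ++ t) (s' ++ t')
| tens_rel_comm s t : tens_rel (s ++ t) (t ++ s)
| tens_rel_zero n : tens_rel [:: (0, n)] [::]
| tens_rel_addl m m' n : tens_rel [:: (m + m', n)] [:: (m, n); (m', n)]
| tens_rel_addr m n n' : tens_rel [:: (m, n + n')] [:: (m, n); (m, n')]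
| tens_rel_bal m r n : tens_rel [:: (ra m r, n)] [:: (m, la r n)].

Definition tens_relb : rel (seq (M * N)) := fun s t => `[< tens_rel s t >].

Lemma tens_relb_equiv : equiv_class_of tens_relb.
Proof.
split=> [s|s t|t s u].
- by apply/asboolP; apply: tens_rel_refl.
- by apply/asboolP/asboolP; apply: tens_rel_sym.
- by move=> /asboolP st /asboolP tu; apply/asboolP; apply: tens_rel_trans tu.
Qed.

Canonical tens_equiv := EquivRelPack tens_relb_equiv.

Definition tens : Type := {eq_quot tens_equiv}.
HB.instance Definition _ := Choice.on tens.
HB.instance Definition _ := EqQuotient.on tens.

Lemma tens_eq (s t : seq (M * N)) : tens_rel s t -> \pi_tens s = \pi_tens t.
Proof. by move=> st; apply/eqquotP/asboolP. Qed.

Lemma tens_eqV (s t : seq (M * N)) : \pi_tens s = \pi_tens t -> tens_rel s t.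
Proof. by move/eqquotP/asboolP. Qed.

Lemma tens_pi (x : tens) : exists s, x = \pi_tens s.
Proof. by exists (repr x); rewrite reprK. Qed.

Lemma tens_repr s : tens_rel (repr (\pi_tens s)) s.
Proof. by apply: tens_eqV; rewrite reprK. Qed.

Definition tens_neg (s : seq (M * N)) := [seq (- p.1, p.2) | p <- s].

Lemma tens_negP s : tens_rel (tens_neg s ++ s) [::].
Proof.
elim: s => [|[m n] s IHs]; first exact: tens_rel_refl.
rewrite /tens_neg /= -/(tens_neg s) -[_ :: _ ++ _]cat1s -[(m, n) :: s]cat1s.
have h : tens_rel (tens_neg s ++ [:: (m, n)] ++ s)
                  ([:: (m, n)] ++ tens_neg s ++ s).
  rewrite !catA; apply: tens_rel_cat (tens_rel_refl _).
  exact: tens_rel_comm.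
apply: tens_rel_trans (tens_rel_cat (tens_rel_refl _) h) _; rewrite catA.
apply: tens_rel_trans IHs; rewrite -[X in tens_rel _ X]cat0s.
apply: tens_rel_cat (tens_rel_refl _).
apply: tens_rel_trans (tens_rel_sym (tens_rel_addl _ _ _)) _.
by rewrite addNr; apply: tens_rel_zero.
Qed.

Lemma tens_rel_neg s t : tens_rel s t -> tens_rel (tens_neg s) (tens_neg t).
Proof.
move=> st.
have h1 : tens_rel (tens_neg s ++ (tens_neg t ++ t)) (tens_neg s).
  by rewrite -[X in tens_rel _ X]cats0; apply: tens_rel_cat (tens_rel_refl _) (tens_negP _).
have h2 : tens_rel (tens_neg s ++ s ++ tens_neg t) (tens_neg t).
  by rewrite catA -[X in tens_rel _ X]cat0s; apply: tens_rel_cat (tens_negP _) (tens_rel_refl _).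
apply: tens_rel_trans (tens_rel_sym h1) _; apply: tens_rel_trans h2.
apply: tens_rel_cat (tens_rel_refl _) _.
apply: tens_rel_trans (tens_rel_comm _ _) _.
by apply: tens_rel_cat (tens_rel_sym st) (tens_rel_refl _).
Qed.

Definition tens_zero : tens := \pi_tens [::].
Definition tens_add (x y : tens) : tens := \pi_tens (repr x ++ repr y).
Definition tens_opp (x : tens) : tens := \pi_tens (tens_neg (repr x)).

Lemma tens_addE s t : tens_add (\pi_tens s) (\pi_tens t) = \pi_tens (s ++ t).
Proof. by apply: tens_eq; apply: tens_rel_cat; apply: tens_repr. Qed.

Lemma tens_oppE s : tens_opp (\pi_tens s) = \pi_tens (tens_neg s).
Proof. by apply: tens_eq; apply: tens_rel_neg; apply: tens_repr. Qed.

Lemma tens_addA : associative tens_add.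
Proof.
move=> x y z; case: (tens_pi x) => s ->; case: (tens_pi y) => t ->.
by case: (tens_pi z) => u ->; rewrite !tens_addE catA.
Qed.

Lemma tens_addC : commutative tens_add.
Proof.
move=> x y; case: (tens_pi x) => s ->; case: (tens_pi y) => t ->; rewrite !tens_addE.
by apply: tens_eq; apply: tens_rel_comm.
Qed.

Lemma tens_add0 : left_id tens_zero tens_add.
Proof. by move=> x; case: (tens_pi x) => s ->; rewrite tens_addE. Qed.

Lemma tens_addN : left_inverse tens_zero tens_opp tens_add.
Proof.
move=> x; case: (tens_pi x) => s ->; rewrite tens_oppE tens_addE.
by apply: tens_eq; apply: tens_negP.
Qed.

HB.instance Definition _ :=
  GRing.isZmodule.Build tens tens_addA tens_addC tens_add0 tens_addN.

Definition pure (m : M) (n : N) : tens := \pi_tens [:: (m, n)].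

Lemma pi_cat s t : \pi_tens (s ++ t) = \pi_tens s + \pi_tens t.
Proof. by rewrite -[RHS]/(tens_add _ _) tens_addE. Qed.

Lemma pi_sum s : \pi_tens s = \sum_(p <- s) pure p.1 p.2.
Proof.
elim: s => [|[m n] s IHs]; first by rewrite big_nil.
by rewrite big_cons -IHs -cat1s pi_cat.
Qed.

Lemma tens_sum (x : tens) : x = \sum_(p <- repr x) pure p.1 p.2.
Proof. by rewrite -pi_sum reprK. Qed.

Lemma pureDl n : {morph pure^~ n : m m' / m + m'}.
Proof. by move=> m m'; rewrite -pi_cat; apply: tens_eq; apply: tens_rel_addl. Qed.

Lemma pureDr m : {morph pure m : n n' / n + n'}.
Proof. by move=> n n'; rewrite -pi_cat; apply: tens_eq; apply: tens_rel_addr. Qed.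

Lemma pure_bal m r n : pure (ra m r) n = pure m (la r n).
Proof. by apply: tens_eq; apply: tens_rel_bal. Qed.

Lemma tens_ind (P : tens -> Prop) : P 0 -> (forall x y, P x -> P y -> P (x + y)) ->
  (forall m n, P (pure m n)) -> forall x, P x.
Proof.
by move=> P0 PD Pp x; rewrite (tens_sum x); elim/big_ind: _.
Qed.

(* The sum of [f m n] over the pure tensors of a chosen representative of [x].
   It does not depend on that choice when [f] is balanced, see [tsum_pi]. *)
Definition tsum (W : nmodType) (f : M -> N -> W) (x : tens) : W :=
  \sum_(p <- repr x) f p.1 p.2.

Definition balanced (W : zmodType) (f : M -> N -> W) : Prop :=
  [/\ forall n, {morph f^~ n : m m' / m + m'},
      forall m, {morph f m : n n' / n + n'} &
      forall m r n, f (ra m r) n = f m (la r n)].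

Lemma balanced_pure : balanced pure.
Proof. by split; [exact: pureDl|exact: pureDr|exact: pure_bal]. Qed.

Section Lift.
Variables (W : zmodType) (f : M -> N -> W).
Hypothesis bf : balanced f.

Lemma tsum_rel s t : tens_rel s t ->
  \sum_(p <- s) f p.1 p.2 = \sum_(p <- t) f p.1 p.2.
Proof.
case: bf => fDl fDr fb; elim=> {s t} //=.
- by move=> s t u _ -> _ ->.
- by move=> s s' t t' _ IHs _ IHt; rewrite !big_cat /= IHs IHt.
- by move=> s t; rewrite !big_cat /= addrC.
- move=> n; rewrite big_seq1 big_nil /=.
  by apply: (addrI (f 0 n)); rewrite -fDl !addr0.
- by move=> m m' n; rewrite !big_cons !big_nil /= fDl !addr0.
- by move=> m n n'; rewrite !big_cons !big_nil /= fDr !addr0.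
- by move=> m r n; rewrite !big_seq1 /= fb.
Qed.

Lemma tsum_pi s : tsum f (\pi_tens s) = \sum_(p <- s) f p.1 p.2.
Proof. exact/tsum_rel/tens_repr. Qed.

Lemma tsum_pure m n : tsum f (pure m n) = f m n.
Proof. by rewrite /pure tsum_pi big_seq1. Qed.

Lemma tsumD : {morph tsum f : x y / x + y}.
Proof.
move=> x y; case: (tens_pi x) => s ->; case: (tens_pi y) => t ->; rewrite -pi_cat !tsum_pi big_cat //=.
Qed.

Lemma tsum0 : tsum f 0 = 0.
Proof. by rewrite -[0]/(\pi_tens [::]) tsum_pi big_nil. Qed.

End Lift.

Lemma eq_tsum (W : nmodType) (f g : M -> N -> W) : f =2 g -> tsum f =1 tsum g.
Proof. by move=> fg x; apply: eq_bigr => p _; apply: fg. Qed.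

Lemma tsum_id x : tsum pure x = x.
Proof. by rewrite /tsum -tens_sum. Qed.

Lemma tsum_fD (W : nmodType) (f g : M -> N -> W) x :
  tsum (fun m n => f m n + g m n) x = tsum f x + tsum g x.
Proof. by rewrite /tsum big_split. Qed.

Lemma tsum_f0 (W : nmodType) x : tsum (fun _ _ => 0 : W) x = 0.
Proof. by rewrite /tsum big1. Qed.

Lemma tsum_morph (W W' : zmodType) (g : W -> W') (f : M -> N -> W) x :
  g 0 = 0 -> {morph g : a b / a + b} ->
  g (tsum f x) = tsum (fun m n => g (f m n)) x.
Proof. by move=> g0 gD; rewrite /tsum (big_morph g gD g0). Qed.

Lemma tens_ext (W : zmodType) (f g : tens -> W) :
  {morph f : x y / x + y} -> {morph g : x y / x + y} ->
  (forall m n, f (pure m n) = g (pure m n)) -> f =1 g.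
Proof.
have m0 (h : tens -> W) : {morph h : x y / x + y} -> h 0 = 0.
  by move=> hD; apply: (addrI (h 0)); rewrite -hD !addr0.
move=> fD gD fg; elim/tens_ind => //; first by rewrite !m0.
by move=> x y fx fy; rewrite fD gD fx fy.
Qed.

End BalancedTensor.

(* The tensor product over the base field k of two k-vector spaces. *)
Definition tensk (k : fieldType) (V U : lmodType k) : Type :=
  tens (fun (v : V) (a : k) => a *: v) (fun a (u : U) => a *: u).
Definition purek (k : fieldType) (V U : lmodType k) (v : V) (u : U) : tensk V U :=
  pure _ _ v u.

(* Sweedler notation: [tsumk f (coprod h)] is the sum of [f h_(1) h_(2)]. *)
Definition tsumk (k : fieldType) (V U : lmodType k) (W : nmodType)
    (f : V -> U -> W) (x : tensk V U) : W := tsum f x.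

Section TensorField.
Variables (k : fieldType) (V U : lmodType k).
Local Notation T := (tensk V U).
HB.instance Definition _ := GRing.Zmodule.on T.

Definition tensk_scale (a : k) (x : T) : T :=
  tsum (fun v u => purek (a *: v) u) x.

Lemma tensk_scale_bal a :
  balanced (fun (v : V) (a : k) => a *: v) (fun a (u : U) => a *: u)
    (fun v u => purek (a *: v) u).
Proof.
split=> [u v v'|v u u'|v b u].
- by rewrite scalerDr; apply: pureDl.
- exact: pureDr.
- by rewrite scalerA mulrC -scalerA; apply: pure_bal.
Qed.

Lemma tensk_scaleE a v u : tensk_scale a (purek v u) = purek (a *: v) u.
Proof. exact/tsum_pure/tensk_scale_bal. Qed.

Lemma tensk_scaleD a : {morph tensk_scale a : x y / x + y}.
Proof. exact/tsumD/tensk_scale_bal. Qed.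

Lemma tensk_scaleA a b x :
  tensk_scale a (tensk_scale b x) = tensk_scale (a * b) x.
Proof.
move: x; apply: tens_ext => [x y|x y|v u]; rewrite ?tensk_scaleD //.
by rewrite !tensk_scaleE scalerA.
Qed.

Lemma tensk_scale1 : left_id 1 tensk_scale.
Proof.
by apply: tens_ext => [x y|x y|v u]; rewrite ?tensk_scaleD ?tensk_scaleE ?scale1r.
Qed.

Lemma tensk_scaleDr : right_distributive tensk_scale +%R.
Proof. by move=> a x y; apply: tensk_scaleD. Qed.

Lemma tensk_scaleDl x : {morph tensk_scale^~ x : a b / a + b}.
Proof.
move=> a b; rewrite /tensk_scale -tsum_fD; apply: eq_tsum => v u.
by rewrite scalerDl; apply: pureDl.
Qed.

HB.instance Definition _ := GRing.Zmodule_isLmodule.Build k T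
  tensk_scaleA tensk_scale1 tensk_scaleDr tensk_scaleDl.

Lemma purekZl a v u : a *: purek v u = purek (a *: v) u.
Proof. exact: tensk_scaleE. Qed.

Definition balancedk (W : zmodType) (f : V -> U -> W) :=
  balanced (fun (v : V) (a : k) => a *: v) (fun a (u : U) => a *: u) f.

Section Lift.
Variables (W : zmodType) (f : V -> U -> W) (bf : balancedk f).
Lemma tsumk_pure v u : tsumk f (purek v u) = f v u.
Proof. exact: tsum_pure. Qed.
Lemma tsumkD : {morph tsumk f : x y / x + y}.
Proof. exact: tsumD. Qed.
Lemma tsumk0 : tsumk f 0 = 0.
Proof. exact: tsum0. Qed.
End Lift.

Lemma eq_tsumk (W : nmodType) (f g : V -> U -> W) :
  f =2 g -> tsumk f =1 tsumk g.
Proof. exact: eq_tsum. Qed.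

Lemma tsumk_fD (W : nmodType) (f g : V -> U -> W) x :
  tsumk (fun m n => f m n + g m n) x = tsumk f x + tsumk g x.
Proof. exact: tsum_fD. Qed.

Lemma tsumk_morph (W W' : zmodType) (g : W -> W') (f : V -> U -> W) x :
  g 0 = 0 -> {morph g : a b / a + b} ->
  g (tsumk f x) = tsumk (fun m n => g (f m n)) x.
Proof. exact: tsum_morph. Qed.

Lemma tsumk_exch (V' U' : lmodType k) (W : nmodType)
    (f : V -> U -> V' -> U' -> W) (x : T) (y : tensk V' U') :
  tsumk (fun v u => tsumk (fun v' u' => f v u v' u') y) x
  = tsumk (fun v' u' => tsumk (fun v u => f v u v' u') x) y.
Proof. by rewrite /tsumk /tsum exchange_big. Qed.
End TensorField.

(* The antipode is part of the data and is required to be invertible. *)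
Record hopfType (k : fieldType) : Type := Hopf {
  hopf_alg :> algType k;
  coprod : {linear hopf_alg -> tensk hopf_alg hopf_alg};
  counit : {lrmorphism hopf_alg -> k | *%R};
  antipode : {linear hopf_alg -> hopf_alg};
  coprodA : forall h : hopf_alg,
    tsumk (fun a b => tsumk (fun a1 a2 => purek a1 (purek a2 b)) (coprod a))
      (coprod h)
    = tsumk (fun a b => purek a (coprod b)) (coprod h);
  counitl : forall h, tsumk (fun a b => counit a *: b) (coprod h) = h;
  counitr : forall h, tsumk (fun a b => counit b *: a) (coprod h) = h;
  coprod1 : coprod 1 = purek 1 1;
  coprodM : forall h g,
    coprod (h * g) =
    tsumk (fun a b => tsumk (fun c d => purek (a * c) (b * d)) (coprod g))
      (coprod h);
  antipodel : forall h,
    tsumk (fun a b => antipode a * b) (coprod h) = (counit h)%:A;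
  antipoder : forall h,
    tsumk (fun a b => a * antipode b) (coprod h) = (counit h)%:A;
  antipode_bij : bijective antipode }.

Arguments coprod {k h0}.
Arguments counit {k h0}.
Arguments antipode {k h0}.

Section LinearExt.
Variables (R : pzRingType) (V W : lmodType R).

Lemma linear_ext (f g : {linear V -> W}) : f =1 g -> f = g.
Proof.
move=> /funext fg; case: f g fg => f cf [g cg] /= fg; subst g.
congr GRing.Linear.Pack; case: cf cg => [[a] [b]] [[a'] [b']].
by congr GRing.Linear.Class; [congr GRing.isNmodMorphism.Axioms_
  |congr GRing.isScalable.Axioms_]; apply: Prop_irrelevance.
Qed.

Definition mk_linear (f : V -> W) (lf : linear f) : {linear V -> W} :=
  HB.pack f (GRing.isLinear.Build _ _ _ _ f lf).

Lemma mk_linearE f (lf : linear f) x : mk_linear lf x = f x.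
Proof. by []. Qed.
End LinearExt.

(* [f \; g] is composition in diagrammatic order: first [f], then [g]. *)
Record category : Type := Category {
  obj :> Type;
  hom : obj -> obj -> Type;
  idm : forall X, hom X X;
  ccomp : forall X Y Z, hom Y Z -> hom X Y -> hom X Z;
  comp1m : forall X Y (f : hom X Y), ccomp (idm Y) f = f;
  compm1 : forall X Y (f : hom X Y), ccomp f (idm X) = f;
  compmA : forall X Y Z W (f : hom Z W) (g : hom Y Z) (h : hom X Y),
    ccomp f (ccomp g h) = ccomp (ccomp f g) h }.

Arguments hom {c} X Y.
Arguments idm {c} X.
Arguments ccomp {c X Y Z} f g.
Notation "f \; g" := (ccomp g f) : category_scope.
Delimit Scope category_scope with cat.
Local Open Scope category_scope.

Record functor (C D : category) : Type := Functor {
  fobj :> C -> D;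
  fmap : forall X Y : C, hom X Y -> hom (fobj X) (fobj Y);
  fmap1 : forall X, fmap (idm X) = idm (fobj X);
  fmapM : forall (X Y Z : C) (f : hom X Y) (g : hom Y Z),
    fmap (f \; g) = fmap f \; fmap g }.
Arguments fmap {C D} F {X Y} f : rename.

Record monoidal : Type := Monoidal {
  mcat :> category;
  mtens : mcat -> mcat -> mcat;
  mtensm : forall X Y X' Y' : mcat,
    hom X X' -> hom Y Y' -> hom (mtens X Y) (mtens X' Y');
  munit : mcat;
  asc : forall X Y Z : mcat, hom (mtens (mtens X Y) Z) (mtens X (mtens Y Z));
  ascV : forall X Y Z : mcat, hom (mtens X (mtens Y Z)) (mtens (mtens X Y) Z);
  luni : forall X : mcat, hom (mtens munit X) X;
  luniV : forall X : mcat, hom X (mtens munit X);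
  runi : forall X : mcat, hom (mtens X munit) X;
  runiV : forall X : mcat, hom X (mtens X munit);
  thom1 : forall X Y, mtensm (idm X) (idm Y) = idm (mtens X Y);
  thomM : forall (X X' X'' Y Y' Y'' : mcat) (f : hom X X') (f' : hom X' X'')
      (g : hom Y Y') (g' : hom Y' Y''),
    mtensm (f \; f') (g \; g') = mtensm f g \; mtensm f' g';
  asc_nat : forall (X X' Y Y' Z Z' : mcat)
      (f : hom X X') (g : hom Y Y') (h : hom Z Z'),
    mtensm (mtensm f g) h \; asc X' Y' Z' = asc X Y Z \; mtensm f (mtensm g h);
  lun_nat : forall (X Y : mcat) (f : hom X Y),
    mtensm (idm munit) f \; luni Y = luni X \; f;
  run_nat : forall (X Y : mcat) (f : hom X Y),
    mtensm f (idm munit) \; runi Y = runi X \; f;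
  ascK : forall X Y Z, asc X Y Z \; ascV X Y Z = idm _;
  ascVK : forall X Y Z, ascV X Y Z \; asc X Y Z = idm _;
  lunK : forall X, luni X \; luniV X = idm _;
  lunVK : forall X, luniV X \; luni X = idm _;
  runK : forall X, runi X \; runiV X = idm _;
  runVK : forall X, runiV X \; runi X = idm _;
  pentagon : forall X Y Z W,
    mtensm (asc X Y Z) (idm W) \; asc X (mtens Y Z) W \; mtensm (idm X) (asc Y Z W)
    = asc (mtens X Y) Z W \; asc X Y (mtens Z W);
  triangle : forall X Y,
    asc X munit Y \; mtensm (idm X) (luni Y) = mtensm (runi X) (idm Y) }.

Arguments mtensm {m X Y X' Y'} f g.
Arguments munit {m}.
Notation "X \ox Y" := (mtens X Y) (at level 40, left associativity)
  : category_scope.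
Notation "f \om g" := (mtensm f g) (at level 40, left associativity)
  : category_scope.

Record lax_structure (C D : monoidal) (F : functor C D) : Type := Lax {
  lax2 : forall X Y : C, hom (F X \ox F Y) (F (X \ox Y));
  lax0 : hom munit (F munit);
  lax_nat : forall (X X' Y Y' : C) (f : hom X X') (g : hom Y Y'),
    fmap F f \om fmap F g \; lax2 X' Y' = lax2 X Y \; fmap F (f \om g);
  lax_asc : forall X Y Z : C,
    lax2 X Y \om idm (F Z) \; lax2 (X \ox Y) Z \; fmap F (asc X Y Z)
    = asc (F X) (F Y) (F Z) \; idm (F X) \om lax2 Y Z \; lax2 X (Y \ox Z);
  lax_lun : forall X : C,
    lax0 \om idm (F X) \; lax2 munit X \; fmap F (luni X) = luni (F X);
  lax_run : forall X : C,
    idm (F X) \om lax0 \; lax2 X munit \; fmap F (runi X) = runi (F X) }.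

Record oplax_structure (C D : monoidal) (F : functor C D) : Type := Oplax {
  oplax2 : forall X Y : C, hom (F (X \ox Y)) (F X \ox F Y);
  oplax0 : hom (F munit) munit;
  oplax_nat : forall (X X' Y Y' : C) (f : hom X X') (g : hom Y Y'),
    fmap F (f \om g) \; oplax2 X' Y' = oplax2 X Y \; fmap F f \om fmap F g;
  oplax_asc : forall X Y Z : C,
    oplax2 (X \ox Y) Z \; oplax2 X Y \om idm (F Z) \; asc (F X) (F Y) (F Z)
    = fmap F (asc X Y Z) \; oplax2 X (Y \ox Z) \; idm (F X) \om oplax2 Y Z;
  oplax_lun : forall X : C,
    oplax2 munit X \; oplax0 \om idm (F X) \; luni (F X) = fmap F (luni X);
  oplax_run : forall X : C,
    oplax2 X munit \; idm (F X) \om oplax0 \; runi (F X) = fmap F (runi X) }.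

(* The two Frobenius identities, with the associators the strict notation
   leaves implicit. *)
Record frobenius_monoidal (C D : monoidal) (F : functor C D) : Type :=
  FrobeniusMonoidal {
  fm_lax :> lax_structure F;
  fm_oplax :> oplax_structure F;
  frobenius_r : forall X Y Z : C,
    idm (F X) \om oplax2 fm_oplax Y Z \; ascV (F X) (F Y) (F Z)
      \; lax2 fm_lax X Y \om idm (F Z)
    = lax2 fm_lax X (Y \ox Z) \; fmap F (ascV X Y Z)
      \; oplax2 fm_oplax (X \ox Y) Z;
  frobenius_l : forall X Y Z : C,
    oplax2 fm_oplax X Y \om idm (F Z) \; asc (F X) (F Y) (F Z)
      \; idm (F X) \om lax2 fm_lax Y Z
    = lax2 fm_lax (X \ox Y) Z \; fmap F (asc X Y Z)
      \; oplax2 fm_oplax X (Y \ox Z) }.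

Definition restr (R S : pzRingType) (f : {rmorphism R -> S}) (V : lmodType S)
  : Type := V.

Section Restriction.
Variables (R S : pzRingType) (f : {rmorphism R -> S}) (V : lmodType S).
Local Notation restr := (restr f V).
HB.instance Definition _ := GRing.Zmodule.on restr.

Definition restr_scale (r : R) (v : restr) : restr := f r *: (v : V).

Lemma restr_scaleA a b v :
  restr_scale a (restr_scale b v) = restr_scale (a * b) v.
Proof. by rewrite /restr_scale scalerA rmorphM. Qed.
Lemma restr_scale1 : left_id 1 restr_scale.
Proof. by move=> v; rewrite /restr_scale rmorph1 scale1r. Qed.
Lemma restr_scaleDr : right_distributive restr_scale +%R.
Proof. by move=> a u v; rewrite /restr_scale scalerDr. Qed.
Lemma restr_scaleDl v : {morph restr_scale^~ v : a b / a + b}.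
Proof. by move=> a b; rewrite /restr_scale rmorphD scalerDl. Qed.

HB.instance Definition _ := GRing.Zmodule_isLmodule.Build R restr
  restr_scaleA restr_scale1 restr_scaleDr restr_scaleDl.

Lemma restrZ (r : R) (v : restr) : r *: v = (f r *: (v : V) : V).
Proof. by []. Qed.
End Restriction.

Lemma algZl (k : fieldType) (A : algType k) (V : lmodType A) c (a : A) (v : V) :
  (c *: a) *: v = c%:A *: (a *: v).
Proof. by rewrite scalerA mulr_algl. Qed.

Lemma algZr (k : fieldType) (A : algType k) (V : lmodType A) c (a : A) (v : V) :
  c%:A *: (a *: v) = a *: (c%:A *: v).
Proof. by rewrite !scalerA mulr_algl mulr_algr. Qed.

Section TensorModule.
Variables (k : fieldType) (H : hopfType k).

Section Def.
Variables (V U : lmodType H).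
(* The underlying space of the tensor product of H-modules is taken over k,
   where k acts on an H-module through c |-> c%:A; H acts diagonally, through
   its coproduct. *)
Definition tmod : Type :=
  tens (fun (v : V) (c : k) => c%:A *: v) (fun c (u : U) => c%:A *: u).
HB.instance Definition _ := GRing.Zmodule.on tmod.

Definition puret (v : V) (u : U) : tmod := pure _ _ v u.

Lemma puretDl u : {morph puret^~ u : v v' / v + v'}.
Proof. exact: pureDl. Qed.
Lemma puretDr v : {morph puret v : u u' / u + u'}.
Proof. exact: pureDr. Qed.
Lemma puret_bal (c : k) v u : puret (c%:A *: v) u = puret v (c%:A *: u).
Proof. exact: pure_bal. Qed.

Definition tact (t : tensk H H) v u : tmod :=
  tsumk (fun a b => puret (a *: v) (b *: u)) t.

Lemma tact_bal v u :
  balancedk (fun a b : H => puret (a *: v) (b *: u)).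
Proof.
split=> [b a a'|a b b'|a c b].
- by rewrite scalerDl puretDl.
- by rewrite scalerDl puretDr.
- by rewrite algZl puret_bal -algZl.
Qed.

Definition tmod_scale (h : H) (x : tmod) : tmod := tsum (tact (coprod h)) x.

Lemma tact_pure a b v u : tact (purek a b) v u = puret (a *: v) (b *: u).
Proof. exact/tsumk_pure/tact_bal. Qed.

Lemma tactD v u : {morph (fun t => tact t v u) : s t / s + t}.
Proof. exact/tsumkD/tact_bal. Qed.

Lemma tact0 v u : tact 0 v u = 0.
Proof. exact/tsumk0/tact_bal. Qed.

Lemma tact_tsum v u (f : H -> H -> tensk H H) (t : tensk H H) :
  tact (tsumk f t) v u = tsumk (fun a b => tact (f a b) v u) t.
Proof. exact: (tsumk_morph _ _ (tact0 v u) (tactD v u)). Qed.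

Lemma tact_balanced t :
  balanced (fun (v : V) (c : k) => c%:A *: v) (fun c (u : U) => c%:A *: u)
    (tact t).
Proof.
split=> [u v v'|v u u'|v c u].
- rewrite /tact -tsumk_fD; apply: eq_tsumk => a b.
  by rewrite scalerDr puretDl.
- rewrite /tact -tsumk_fD; apply: eq_tsumk => a b.
  by rewrite scalerDr puretDr.
- apply: eq_tsumk => a b; rewrite -[X in puret X _]algZr -[X in _ = puret _ X]algZr.
  by rewrite puret_bal.
Qed.

Lemma tmod_scaleE h v u : tmod_scale h (puret v u) = tact (coprod h) v u.
Proof. exact/tsum_pure/tact_balanced. Qed.

Lemma tmod_scaleDr : right_distributive tmod_scale +%R.
Proof. by move=> a x y; apply/tsumD/tact_balanced. Qed.

Lemma tmod_scale0 h : tmod_scale h 0 = 0.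
Proof. exact/tsum0/tact_balanced. Qed.

Lemma tmod_scale_tsum (h : H) (A B : lmodType k) (f : A -> B -> tmod)
    (t : tensk A B) :
  tmod_scale h (tsumk f t) = tsumk (fun a b => tmod_scale h (f a b)) t.
Proof. exact: (tsumk_morph _ _ (tmod_scale0 h) (tmod_scaleDr h)). Qed.

Lemma tmod_scaleA a b x : tmod_scale a (tmod_scale b x) = tmod_scale (a * b) x.
Proof.
move: x; apply: tens_ext => [x y|x y|v u]; rewrite ?tmod_scaleDr //.
rewrite !tmod_scaleE coprodM tact_tsum {1}/tact tmod_scale_tsum.
under eq_tsumk do rewrite tmod_scaleE /tact.
rewrite tsumk_exch; apply: eq_tsumk => c d; rewrite tact_tsum.
by apply: eq_tsumk => c' d'; rewrite tact_pure !scalerA.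
Qed.

Lemma tmod_scale1 : left_id 1 tmod_scale.
Proof.
apply: tens_ext => [x y|x y|v u]; rewrite ?tmod_scaleDr // tmod_scaleE coprod1.
by rewrite tact_pure !scale1r.
Qed.

Lemma tmod_scaleDl x : {morph tmod_scale^~ x : a b / a + b}.
Proof.
move=> a b; rewrite /tmod_scale -tsum_fD; apply: eq_tsum => v u.
by rewrite linearD tactD.
Qed.

HB.instance Definition _ := GRing.Zmodule_isLmodule.Build H tmod
  tmod_scaleA tmod_scale1 tmod_scaleDr tmod_scaleDl.

Lemma puretZ (h : H) v u :
  h *: puret v u = tsumk (fun a b => puret (a *: v) (b *: u)) (coprod h).
Proof. exact: tmod_scaleE. Qed.
End Def.

Lemma puretZk (V U : lmodType H) (c : k) (v : V) (u : U) :
  (c%:A : H) *: puret v u = puret ((c%:A : H) *: v) u.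
Proof. by rewrite puretZ linearZ /= coprod1 purekZl -/(tact _ v u) tact_pure scale1r. Qed.

Definition balancedt (V U : lmodType H) (W : zmodType) (f : V -> U -> W) :=
  balanced (fun (v : V) (c : k) => c%:A *: v) (fun c (u : U) => c%:A *: u) f.

Definition tsumt (V U : lmodType H) (W : nmodType) (f : V -> U -> W)
  (x : tmod V U) : W := tsum f x.

Lemma tmod_ext (V U : lmodType H) (W : zmodType) (f g : tmod V U -> W) :
  {morph f : x y / x + y} -> {morph g : x y / x + y} ->
  (forall v u, f (puret v u) = g (puret v u)) -> f =1 g.
Proof. exact: tens_ext. Qed.

Lemma tmod_linear_ext (V U W : lmodType H) (f g : {linear tmod V U -> W}) :
  (forall v u, f (puret v u) = g (puret v u)) -> f =1 g.
Proof. by apply: tmod_ext; apply: raddfD. Qed.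

Lemma tmod_linear_ext3 (V U W X : lmodType H)
    (f g : {linear tmod (tmod V U) W -> X}) :
  (forall v u w, f (puret (puret v u) w) = g (puret (puret v u) w)) -> f =1 g.
Proof.
move=> fg; apply: tmod_linear_ext => x w; move: x; apply: tmod_ext => //.
- by move=> x y; rewrite puretDl linearD.
- by move=> x y; rewrite puretDl linearD.
Qed.

Lemma tmod_linear_ext4 (V U W X Y : lmodType H)
    (f g : {linear tmod (tmod (tmod V U) W) X -> Y}) :
  (forall v u w x, f (puret (puret (puret v u) w) x)
                 = g (puret (puret (puret v u) w) x)) -> f =1 g.
Proof.
move=> fg; apply: tmod_linear_ext3 => a w x; move: a; apply: tmod_ext => //.
- by move=> a b; rewrite !puretDl linearD.
- by move=> a b; rewrite !puretDl linearD.
Qed.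

Section Lift.
Variables (V U W : lmodType H) (f : V -> U -> W).
Hypothesis bf : balancedt f.
Hypothesis lf : forall h v u,
  tsumk (fun a b => f (a *: v) (b *: u)) (coprod h) = h *: f v u.

Lemma tsumt_pure v u : tsumt f (puret v u) = f v u.
Proof. exact: tsum_pure. Qed.
Lemma tsumtD : {morph tsumt f : x y / x + y}.
Proof. exact: tsumD. Qed.
Lemma tsumt0 : tsumt f 0 = 0.
Proof. exact: tsum0. Qed.

Lemma tsumt_linear : linear (tsumt f).
Proof.
move=> h x y; rewrite tsumtD; congr (_ + _); move: x; apply: tmod_ext.
- by move=> x z; rewrite scalerDr tsumtD.
- by move=> x z; rewrite tsumtD scalerDr.
move=> v u; rewrite puretZ (tsumk_morph _ _ tsumt0 tsumtD) tsumt_pure -lf.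
by apply: eq_tsumk => a b; rewrite tsumt_pure.
Qed.

Definition tmod_lift : {linear tmod V U -> W} := mk_linear tsumt_linear.

Lemma tmod_liftE v u : tmod_lift (puret v u) = f v u.
Proof. exact: tsumt_pure. Qed.
End Lift.

Section Hom.
Variables (V V' U U' : lmodType H) (f : {linear V -> V'}) (g : {linear U -> U'}).

Lemma tmod_hom_bal : balancedt (fun v u => puret (f v) (g u)).
Proof.
split=> [u v v'|v u u'|v c u]; rewrite ?linearD ?puretDl ?puretDr //.
by rewrite !linearZ puret_bal.
Qed.

Lemma tmod_hom_lin h v u :
  tsumk (fun a b => puret (f (a *: v)) (g (b *: u))) (coprod h)
  = h *: puret (f v) (g u).
Proof. by rewrite puretZ; apply: eq_tsumk => a b; rewrite !linearZ. Qed.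

Definition tmod_hom : {linear tmod V U -> tmod V' U'} :=
  tmod_lift tmod_hom_bal tmod_hom_lin.

Lemma tmod_homE v u : tmod_hom (puret v u) = puret (f v) (g u).
Proof. exact: tmod_liftE. Qed.
End Hom.

Lemma puret0l (V U : lmodType H) (u : U) : puret (0 : V) u = 0.
Proof. by apply: (addrI (puret 0 u)); rewrite -puretDl !addr0. Qed.
Lemma puret0r (V U : lmodType H) (v : V) : puret v (0 : U) = 0.
Proof. by apply: (addrI (puret v 0)); rewrite -puretDr !addr0. Qed.

Lemma puret_tsumkr (A B : lmodType k) (V U : lmodType H) (v : V)
    (f : A -> B -> U) t :
  puret v (tsumk f t) = tsumk (fun a b => puret v (f a b)) t.
Proof. exact: (tsumk_morph _ _ (puret0r _ v) (puretDr v)). Qed.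

Section Assoc.
Variables V U W : lmodType H.

Definition asc_fun (x : tmod V U) (w : W) : tmod V (tmod U W) :=
  tsumt (fun v u => puret v (puret u w)) x.

Lemma asc_fun_bal0 (w : W) : balancedt (fun (v : V) (u : U) => puret v (puret u w)).
Proof.
split=> [u v v'|v u u'|v c u]; rewrite ?puretDl ?puretDr //.
by rewrite puret_bal puretZk.
Qed.

Lemma asc_funE v u w : asc_fun (puret v u) w = puret v (puret u w).
Proof. exact/tsumt_pure/asc_fun_bal0. Qed.

Lemma asc_funDl w : {morph asc_fun^~ w : x y / x + y}.
Proof. exact/tsumtD/asc_fun_bal0. Qed.

Lemma asc_fun0l w : asc_fun 0 w = 0.
Proof. exact/tsumt0/asc_fun_bal0. Qed.

Lemma asc_fun_tsumk (A B : lmodType k) (f : A -> B -> tmod V U) t w :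
  asc_fun (tsumk f t) w = tsumk (fun a b => asc_fun (f a b) w) t.
Proof.
exact: (tsumk_morph (g := asc_fun^~ w) _ _ (asc_fun0l w) (asc_funDl w)).
Qed.

Lemma asc_fun_bal : balancedt asc_fun.
Proof.
split=> [w x x'|x w w'|x c w]; first exact: asc_funDl.
- move: x; apply: tmod_ext => [x y|x y|v u]; rewrite ?asc_funDl //.
    by rewrite addrACA.
  by rewrite !asc_funE !puretDr.
- move: x; apply: tmod_ext => [x y|x y|v u]; rewrite ?scalerDr ?asc_funDl //.
  by rewrite puretZk !asc_funE puret_bal puretZk puret_bal.
Qed.

Lemma asc_fun_lin h x w :
  tsumk (fun a b => asc_fun (a *: x) (b *: w)) (coprod h) = h *: asc_fun x w.
Proof.
move: x; apply: tmod_ext => [x y|x y|v u].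
- by rewrite -tsumk_fD; apply: eq_tsumk => a b; rewrite scalerDr asc_funDl.
- by rewrite asc_funDl scalerDr.
rewrite asc_funE puretZ.
pose G1 (a : H) (b c : H) : tmod V (tmod U W) :=
  puret (a *: v) (puret (b *: u) (c *: w)).
have bG1 a : balancedk (G1 a).
  split=> [c b b'|b c c'|b r c]; rewrite /G1.
  - by rewrite scalerDl puretDl puretDr.
  - by rewrite scalerDl !puretDr.
  - by rewrite algZl puret_bal -algZl.
pose G (a : H) (t : tensk H H) := tsumk (G1 a) t.
have bG : balancedk G.
  split=> [t a a'|a t t'|a r t]; rewrite /G.
  - rewrite -tsumk_fD; apply: eq_tsumk => b c.
    by rewrite /G1 scalerDl puretDl.
  - exact: tsumkD.
  - move: t; apply: tens_ext => [x y|x y|b c].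
    + exact: tsumkD.
    + by rewrite scalerDr tsumkD.
    rewrite -/(purek b c) purekZl !tsumk_pure // /G1.
    by rewrite algZl puret_bal puretZk -algZl.
have := congr1 (tsumk G) (coprodA h).
rewrite !(tsumk_morph _ _ (tsumk0 bG) (tsumkD bG)) => E.
transitivity (tsumk (fun a b => tsumk G
   (tsumk (fun a1 a2 => purek a1 (purek a2 b)) (coprod a))) (coprod h)).
  apply: eq_tsumk => a b; rewrite puretZ.
  rewrite asc_fun_tsumk.
  rewrite (tsumk_morph _ _ (tsumk0 bG) (tsumkD bG)).
  apply: eq_tsumk => a1 a2; rewrite asc_funE.
  by rewrite tsumk_pure // /G tsumk_pure.
rewrite E; apply: eq_tsumk => a b; rewrite tsumk_pure // /G puretZ.
rewrite puret_tsumkr.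
exact: eq_tsumk.
Qed.

Definition mod_asc : {linear tmod (tmod V U) W -> tmod V (tmod U W)} :=
  tmod_lift asc_fun_bal asc_fun_lin.

Lemma mod_ascE v u w :
  mod_asc (puret (puret v u) w) = puret v (puret u w).
Proof. by rewrite /mod_asc tmod_liftE asc_funE. Qed.

Definition ascV_fun (v : V) (x : tmod U W) : tmod (tmod V U) W :=
  tsumt (fun u w => puret (puret v u) w) x.

Lemma ascV_fun_bal0 (v : V) : balancedt (fun (u : U) (w : W) => puret (puret v u) w).
Proof.
split=> [w u u'|u w w'|u c w]; rewrite ?puretDl ?puretDr ?puretDl //.
by rewrite -puret_bal -puretZk puret_bal.
Qed.

Lemma ascV_funE v u w : ascV_fun v (puret u w) = puret (puret v u) w.
Proof. exact/tsumt_pure/ascV_fun_bal0. Qed.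

Lemma ascV_funD v : {morph ascV_fun v : x y / x + y}.
Proof. exact/tsumtD/ascV_fun_bal0. Qed.

Lemma ascV_fun0 v : ascV_fun v 0 = 0.
Proof. exact/tsumt0/ascV_fun_bal0. Qed.

Lemma ascV_fun_bal : balancedt ascV_fun.
Proof.
split=> [x v v'|v x x'|v c x]; last 1 first.
- move: x; apply: tmod_ext => [x y|x y|u w]; rewrite ?scalerDr ?ascV_funD //.
  by rewrite puretZk !ascV_funE puret_bal.
- move: x; apply: tmod_ext => [x y|x y|u w]; rewrite ?ascV_funD //.
    by rewrite addrACA.
  by rewrite !ascV_funE !puretDl.
- exact: ascV_funD.
Qed.

Definition mod_ascV_fun : tmod V (tmod U W) -> tmod (tmod V U) W :=
  tsumt ascV_fun.

Lemma mod_ascV_funD : {morph mod_ascV_fun : x y / x + y}.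
Proof. exact/tsumtD/ascV_fun_bal. Qed.

Lemma mod_ascV_funE v u w :
  mod_ascV_fun (puret v (puret u w)) = puret (puret v u) w.
Proof. by rewrite /mod_ascV_fun (tsumt_pure ascV_fun_bal) ascV_funE. Qed.

Lemma mod_ascK : cancel mod_asc mod_ascV_fun.
Proof.
apply: tmod_ext => [x y|//|x w]; first by rewrite linearD mod_ascV_funD.
move: x; apply: tmod_ext => [x y|x y|v u]; rewrite ?puretDl //.
  by rewrite linearD mod_ascV_funD.
by rewrite mod_ascE mod_ascV_funE.
Qed.

Lemma mod_ascVK : cancel mod_ascV_fun mod_asc.
Proof.
apply: tmod_ext => [x y|//|v x]; first by rewrite mod_ascV_funD linearD.
move: x; apply: tmod_ext => [x y|x y|u w]; rewrite ?puretDr //.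
  by rewrite mod_ascV_funD linearD.
by rewrite mod_ascV_funE mod_ascE.
Qed.

Lemma mod_ascV_linear : linear mod_ascV_fun.
Proof.
move=> h x y; apply: (can_inj mod_ascK).
by rewrite linearP !mod_ascVK.
Qed.

Definition mod_ascV : {linear tmod V (tmod U W) -> tmod (tmod V U) W} :=
  mk_linear mod_ascV_linear.

Lemma mod_ascVE v u w :
  mod_ascV (puret v (puret u w)) = puret (puret v u) w.
Proof. exact: mod_ascV_funE. Qed.
End Assoc.

(* The ground field with H acting through the counit. *)
Definition unitm : Type := restr (@counit k H) (k^o : lmodType k).
HB.instance Definition _ := GRing.Lmodule.on unitm.
Definition unit_el (c : k) : unitm := c.
Coercion unit_val (x : unitm) : k := x.

Lemma unitmZ (h : H) (x : unitm) : h *: x = unit_el (counit h * x).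
Proof. by []. Qed.

Lemma counit_alg (c : k) : counit (c%:A : H) = c.
Proof. by rewrite linearZ /= rmorph1 mulr1. Qed.

Lemma algZM (V : lmodType H) (a b : k) (v : V) :
  (a * b)%:A *: v = a%:A *: (b%:A *: v).
Proof. by rewrite -scalerA -algZl. Qed.

Section Unitors.
Variable V : lmodType H.

Lemma scale_tsumk (A B : lmodType k) (f : A -> B -> H) t (v : V) :
  tsumk f t *: v = tsumk (fun a b => f a b *: v) t.
Proof.
apply: (tsumk_morph (g := fun h : H => h *: v)) => [|a b]; first exact: scale0r.
exact: scalerDl.
Qed.

Definition lun_fun (x : unitm) (v : V) : V := (unit_val x)%:A *: v.
Definition run_fun (v : V) (x : unitm) : V := (unit_val x)%:A *: v.

Lemma lun_bal : balancedt lun_fun.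
Proof.
rewrite /lun_fun; split=> [v x x'|x v v'|x c v].
- by rewrite -scalerDl -scalerDl.
- by rewrite scalerDr.
- by rewrite unitmZ counit_alg mulrC algZM.
Qed.

Lemma run_bal : balancedt run_fun.
Proof.
rewrite /run_fun; split=> [x v v'|v x x'|v c x].
- by rewrite scalerDr.
- by rewrite -scalerDl -scalerDl.
- by rewrite unitmZ counit_alg mulrC algZM.
Qed.

Lemma lun_lin h x v :
  tsumk (fun a b => lun_fun (a *: x) (b *: v)) (coprod h) = h *: lun_fun x v.
Proof.
rewrite -{2}[h]counitl scale_tsumk; apply: eq_tsumk => a b.
rewrite /lun_fun unitmZ /= algZM [RHS]algZl.
by congr (_ *: _); apply: algZr.
Qed.

Lemma run_lin h v x :
  tsumk (fun a b => run_fun (a *: v) (b *: x)) (coprod h) = h *: run_fun v x.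
Proof.
rewrite -{2}[h]counitr scale_tsumk; apply: eq_tsumk => a b.
rewrite /run_fun unitmZ /= algZM [RHS]algZl.
by congr (_ *: _); apply: algZr.
Qed.

Definition mod_lun : {linear tmod unitm V -> V} := tmod_lift lun_bal lun_lin.
Definition mod_run : {linear tmod V unitm -> V} := tmod_lift run_bal run_lin.

Lemma mod_lunE c v : mod_lun (puret (unit_el c) v) = c%:A *: v.
Proof. exact: tmod_liftE. Qed.
Lemma mod_runE c v : mod_run (puret v (unit_el c)) = c%:A *: v.
Proof. exact: tmod_liftE. Qed.

Definition lunV_fun (v : V) : tmod unitm V := puret (unit_el 1) v.
Definition runV_fun (v : V) : tmod V unitm := puret v (unit_el 1).

Lemma unit_elE c : unit_el c = (c%:A : H) *: unit_el 1.
Proof. by rewrite unitmZ counit_alg mulr1. Qed.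

Lemma mod_lunK : cancel mod_lun lunV_fun.
Proof.
apply: tmod_ext => [x y|//|x v]; first by rewrite linearD /lunV_fun puretDr.
by rewrite mod_lunE /lunV_fun -puret_bal -unit_elE.
Qed.

Lemma mod_lunVK : cancel lunV_fun mod_lun.
Proof. by move=> v; rewrite mod_lunE !scale1r. Qed.

Lemma mod_runK : cancel mod_run runV_fun.
Proof.
apply: tmod_ext => [x y|//|v x]; first by rewrite linearD /runV_fun puretDl.
by rewrite mod_runE /runV_fun puret_bal -unit_elE.
Qed.

Lemma mod_runVK : cancel runV_fun mod_run.
Proof. by move=> v; rewrite mod_runE !scale1r. Qed.

Lemma mod_lunV_linear : linear lunV_fun.
Proof.
by move=> h x y; apply: (can_inj mod_lunK); rewrite linearP !mod_lunVK.
Qed.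

Lemma mod_runV_linear : linear runV_fun.
Proof.
by move=> h x y; apply: (can_inj mod_runK); rewrite linearP !mod_runVK.
Qed.

Definition mod_lunV : {linear V -> tmod unitm V} := mk_linear mod_lunV_linear.
Definition mod_runV : {linear V -> tmod V unitm} := mk_linear mod_runV_linear.
End Unitors.
End TensorModule.

Definition lcomp (R : pzRingType) (V U W : lmodType R)
  (g : {linear U -> W}) (f : {linear V -> U}) : {linear V -> W} := g \o f.
Definition lid (R : pzRingType) (V : lmodType R) : {linear V -> V} := idfun.


Lemma lcompE (R : pzRingType) (V U W : lmodType R)
  (g : {linear U -> W}) (f : {linear V -> U}) x : lcomp g f x = g (f x).
Proof. by []. Qed.

Lemma lidE (R : pzRingType) (V : lmodType R) (x : V) : lid V x = x.
Proof. by []. Qed.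

Definition Mod (R : pzRingType) : category.
Proof.
refine (@Category (lmodType R) (fun V W => {linear V -> W})
  (fun V => lid V) (fun V U W g f => lcomp g f) _ _ _).
- by move=> V W f; apply: linear_ext.
- by move=> V W f; apply: linear_ext.
- by move=> V W U X f g h; apply: linear_ext.
Defined.

Section ModMonoidal.
Variables (k : fieldType) (H : hopfType k).
Implicit Types V U W X : lmodType H.

Lemma tmod_hom1 V U : tmod_hom (lid V) (lid U) = lid (tmod V U).
Proof. by apply/linear_ext/tmod_linear_ext => v u; rewrite tmod_homE. Qed.

Lemma tmod_homM V V' V'' U U' U'' (f : {linear V -> V'})
    (f' : {linear V' -> V''}) (g : {linear U -> U'}) (g' : {linear U' -> U''}) :
  tmod_hom (lcomp f' f) (lcomp g' g) = lcomp (tmod_hom f' g') (tmod_hom f g).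
Proof.
by apply/linear_ext/tmod_linear_ext => v u; rewrite !(lcompE, tmod_homE).
Qed.

Lemma mod_asc_nat V V' U U' W W' (f : {linear V -> V'})
    (g : {linear U -> U'}) (h : {linear W -> W'}) :
  lcomp (mod_asc V' U' W') (tmod_hom (tmod_hom f g) h)
  = lcomp (tmod_hom f (tmod_hom g h)) (mod_asc V U W).
Proof.
apply/linear_ext/tmod_linear_ext3 => v u w.
by rewrite !(lcompE, mod_ascE, tmod_homE).
Qed.

Lemma mod_lun_nat V U (f : {linear V -> U}) :
  lcomp (mod_lun U) (tmod_hom (lid (unitm H)) f) = lcomp f (mod_lun V).
Proof.
apply/linear_ext/tmod_linear_ext => c v.
by rewrite !(lcompE, tmod_homE) !mod_lunE linearZ.
Qed.

Lemma mod_run_nat V U (f : {linear V -> U}) :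
  lcomp (mod_run U) (tmod_hom f (lid (unitm H))) = lcomp f (mod_run V).
Proof.
apply/linear_ext/tmod_linear_ext => v c.
by rewrite !(lcompE, tmod_homE) !mod_runE linearZ.
Qed.

Lemma mod_pentagon V U W X :
  lcomp (lcomp (tmod_hom (lid V) (mod_asc U W X)) (mod_asc V (tmod U W) X))
    (tmod_hom (mod_asc V U W) (lid X))
  = lcomp (mod_asc V U (tmod W X)) (mod_asc (tmod V U) W X).
Proof.
apply/linear_ext/tmod_linear_ext4 => v u w x.
by rewrite !(lcompE, mod_ascE, tmod_homE, lidE).
Qed.

Lemma mod_triangle V U :
  lcomp (tmod_hom (lid V) (mod_lun U)) (mod_asc V (unitm H) U)
  = tmod_hom (mod_run V) (lid U).
Proof.
apply/linear_ext/tmod_linear_ext3 => v c u.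
by rewrite lcompE mod_ascE !tmod_homE mod_lunE mod_runE puret_bal.
Qed.

Definition HMod : monoidal.
Proof.
refine (@Monoidal (Mod H) (fun V U : lmodType H => (tmod V U : lmodType H))
  (fun V U V' U' f g => tmod_hom f g) (unitm H)
  (fun V U W => mod_asc V U W) (fun V U W => mod_ascV V U W)
  (fun V => mod_lun V) (fun V => mod_lunV V)
  (fun V => mod_run V) (fun V => mod_runV V) _ _ _ _ _ _ _ _ _ _ _ _ _).
- exact: tmod_hom1.
- exact: tmod_homM.
- exact: mod_asc_nat.
- exact: mod_lun_nat.
- exact: mod_run_nat.
- by move=> V U W; apply: linear_ext => x; apply: mod_ascK.
- by move=> V U W; apply: linear_ext => x; apply: mod_ascVK.
- by move=> V; apply: linear_ext => x; apply: mod_lunK.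
- by move=> V; apply: linear_ext => x; apply: mod_lunVK.
- by move=> V; apply: linear_ext => x; apply: mod_runK.
- by move=> V; apply: linear_ext => x; apply: mod_runVK.
- exact: mod_pentagon.
- exact: mod_triangle.
Defined.
End ModMonoidal.

Definition fcomp (C D E : category) (G : functor D E) (F : functor C D) :
  functor C E.
Proof.
refine (@Functor C E (fun X => G (F X)) (fun X Y f => fmap G (fmap F f)) _ _).
- by move=> X; rewrite !fmap1.
- by move=> X Y Z f g; rewrite !fmapM.
Defined.

Definition full_sub (C : category) (P : C -> Prop) : category.
Proof.
refine (@Category {X : C | P X} (fun X Y => hom (sval X) (sval Y))
  (fun X => idm (sval X)) (fun X Y Z g f => ccomp g f) _ _ _).
- by move=> X Y f; apply: comp1m.
- by move=> X Y f; apply: compm1.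
- by move=> X Y Z W f g h; apply: compmA.
Defined.

Definition full_incl (C : category) (P : C -> Prop) : functor (full_sub P) C.
Proof.
by refine (@Functor (full_sub P) C (fun X => sval X) (fun X Y f => f) _ _).
Defined.

(* F restricts to a functor between the full subcategories of the objects
   satisfying P and Q. *)
Definition restricts (C D : category) (F : functor C D) (P : C -> Prop)
    (Q : D -> Prop) : Prop :=
  exists G : functor (full_sub P) (full_sub Q),
    fcomp (full_incl Q) G = fcomp F (full_incl P).

Lemma restrictsP C D (F : functor C D) P Q :
  (forall X, P X -> Q (F X)) -> restricts F P Q.
Proof.
move=> h.
unshelve eexists (@Functor (full_sub P) (full_sub Q)
  (fun X => exist Q (F (sval X)) (h _ (svalP X))) (fun X Y f => fmap F f) _ _).
- by move=> X; apply: fmap1.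
- by move=> X Y Z f g; apply: fmapM.
rewrite /fcomp /=; congr Functor; apply: Prop_irrelevance.
Qed.

Definition indm (R S : nzRingType) (i : {rmorphism R -> S}) (V : lmodType R) :
  Type := tens (fun (s : S) (r : R) => s * i r) (fun r (v : V) => r *: v).

Section InducedModule.
Variables (R S : nzRingType) (i : {rmorphism R -> S}).

Section Def.
Variable V : lmodType R.
Local Notation T := (indm i V).
HB.instance Definition _ := GRing.Zmodule.on T.

Definition puri (s : S) (v : V) : T := pure _ _ s v.

Lemma puriDl v : {morph puri^~ v : s s' / s + s'}.
Proof. exact: pureDl. Qed.
Lemma puriDr s : {morph puri s : v v' / v + v'}.
Proof. exact: pureDr. Qed.
Lemma puri_bal s r v : puri (s * i r) v = puri s (r *: v).
Proof. exact: pure_bal. Qed.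

Definition indm_scale (a : S) (x : T) : T := tsum (fun s v => puri (a * s) v) x.

Lemma indm_scale_bal a :
  balanced (fun (s : S) (r : R) => s * i r) (fun r (v : V) => r *: v)
    (fun s v => puri (a * s) v).
Proof.
split=> [v s s'|s v v'|s r v]; first by rewrite mulrDr puriDl.
- exact: puriDr.
- by rewrite mulrA puri_bal.
Qed.

Lemma indm_scaleE a s v : indm_scale a (puri s v) = puri (a * s) v.
Proof. exact/tsum_pure/indm_scale_bal. Qed.

Lemma indm_scaleDr : right_distributive indm_scale +%R.
Proof. by move=> a; apply/tsumD/indm_scale_bal. Qed.

Lemma indm_scaleA a b x : indm_scale a (indm_scale b x) = indm_scale (a * b) x.
Proof.
move: x; apply: tens_ext => [x y|x y|s v]; rewrite ?indm_scaleDr //.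
by rewrite !indm_scaleE mulrA.
Qed.

Lemma indm_scale1 : left_id 1 indm_scale.
Proof.
by apply: tens_ext => [x y|x y|s v]; rewrite ?indm_scaleDr ?indm_scaleE ?mul1r.
Qed.

Lemma indm_scaleDl x : {morph indm_scale^~ x : a b / a + b}.
Proof.
move=> a b; rewrite /indm_scale -tsum_fD; apply: eq_tsum => s v.
by rewrite mulrDl puriDl.
Qed.

HB.instance Definition _ := GRing.Zmodule_isLmodule.Build S T
  indm_scaleA indm_scale1 indm_scaleDr indm_scaleDl.

Lemma puriZ (a s : S) v : a *: puri s v = puri (a * s) v.
Proof. exact: indm_scaleE. Qed.
End Def.

Lemma indm_ext (V : lmodType R) (W : zmodType) (f g : indm i V -> W) :
  {morph f : x y / x + y} -> {morph g : x y / x + y} ->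
  (forall s v, f (puri s v) = g (puri s v)) -> f =1 g.
Proof. exact: tens_ext. Qed.

Lemma indm_linear_ext (V : lmodType R) (W : lmodType S)
    (f g : {linear indm i V -> W}) :
  (forall s v, f (puri s v) = g (puri s v)) -> f = g.
Proof. by move=> fg; apply/linear_ext/indm_ext => // x y; apply: raddfD. Qed.

Section Hom.
Variables (V W : lmodType R) (f : {linear V -> W}).

Definition indm_hom_fun : indm i V -> indm i W :=
  tsum (fun s v => puri s (f v)).

Lemma indm_hom_bal :
  balanced (fun (s : S) (r : R) => s * i r) (fun r (v : V) => r *: v)
    (fun s v => puri s (f v)).
Proof.
split=> [v s s'|s v v'|s r v]; rewrite ?puriDl ?linearD ?puriDr //.
by rewrite puri_bal linearZ.
Qed.

Lemma indm_hom_funE s v : indm_hom_fun (puri s v) = puri s (f v).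
Proof. exact/tsum_pure/indm_hom_bal. Qed.

Lemma indm_hom_funD : {morph indm_hom_fun : x y / x + y}.
Proof. exact/tsumD/indm_hom_bal. Qed.

Lemma indm_hom_linear : linear indm_hom_fun.
Proof.
move=> a x y; rewrite indm_hom_funD; congr (_ + _).
move: x; apply: indm_ext => [x z|x z|s v].
- by rewrite scalerDr indm_hom_funD.
- by rewrite indm_hom_funD scalerDr.
- by rewrite puriZ !indm_hom_funE puriZ.
Qed.

Definition indm_hom : {linear indm i V -> indm i W} := mk_linear indm_hom_linear.

Lemma indm_homE s v : indm_hom (puri s v) = puri s (f v).
Proof. exact: indm_hom_funE. Qed.
End Hom.

Lemma indm_hom1 V : indm_hom (lid V) = lid (indm i V).
Proof. by apply: indm_linear_ext => s v; rewrite indm_homE. Qed.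

Lemma indm_homM (V W X : lmodType R) (f : {linear V -> W}) (g : {linear W -> X}) :
  indm_hom (lcomp g f) = lcomp (indm_hom g) (indm_hom f).
Proof. by apply: indm_linear_ext => s v; rewrite lcompE !indm_homE. Qed.

Definition Ind : functor (Mod R) (Mod S) :=
  @Functor (Mod R) (Mod S) (fun V : lmodType R => (indm i V : lmodType S))
    indm_hom indm_hom1 indm_homM.
End InducedModule.

Record hopfExt (k : fieldType) (K H : hopfType k) : Type := HopfExt {
  incl :> {lrmorphism K -> H};
  incl_inj : injective incl;
  incl_coprod : forall x : K,
    coprod (incl x) = tsumk (fun a b => purek (incl a) (incl b)) (coprod x);
  incl_counit : forall x : K, counit (incl x) = counit x;
  incl_antipode : forall x : K, antipode (incl x) = incl (antipode x) }.

(* The left ideal H K^+ of H, where K^+ is the kernel of the counit of K. *)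
Definition HKplus (k : fieldType) (K H : hopfType k) (i : hopfExt K H)
    : pred H := fun h => `[< exists s : seq (H * K),
  (forall p, p \in s -> counit p.2 = 0) /\ h = \sum_(p <- s) p.1 * i p.2 >].

Section Quotient.
Variables (k : fieldType) (K H : hopfType k) (i : hopfExt K H).
Local Notation I := (HKplus i).

Lemma HKplusP h : reflect (exists s : seq (H * K),
  (forall p, p \in s -> counit p.2 = 0) /\ h = \sum_(p <- s) p.1 * i p.2)
  (h \in I).
Proof. exact: asboolP. Qed.

Lemma HKplusM (a h : H) : h \in I -> a * h \in I.
Proof.
move=> /HKplusP[s [s0 ->]]; apply/HKplusP; exists [seq (a * p.1, p.2) | p <- s].
split=> [_ /mapP[p ps ->]|]; first exact: (s0 p ps).
by rewrite big_map mulr_sumr; apply: eq_bigr => p _; rewrite mulrA.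
Qed.

Lemma HKplus_closed : zmod_closed I.
Proof.
split=> [|x y].
  by apply/HKplusP; exists [::]; rewrite big_nil.
have -> : - y = -1 * y by rewrite mulN1r.
move=> /HKplusP[s [s0 ->]] /(HKplusM (-1)) /HKplusP[t [t0 ->]].
apply/HKplusP; exists (s ++ t); rewrite big_cat; split=> // p.
by rewrite mem_cat => /orP[/s0|/t0].
Qed.

Definition HKplus_zmod : zmodClosed H :=
  HB.pack I (GRing.isZmodClosed.Build H I HKplus_closed).

Lemma HKplusZ (c : k) (h : H) : h \in I -> c *: h \in I.
Proof. by rewrite -mulr_algl; apply: HKplusM. Qed.

Definition Hbar : Type := Quotient.quot HKplus_zmod.
HB.instance Definition _ := GRing.Zmodule.on Hbar.

Definition bar (h : H) : Hbar := \pi_(Quotient.quot HKplus_zmod) h.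

Lemma bar_eq g h : bar g = bar h <-> g - h \in I.
Proof.
rewrite -[_ \in I]/(g - h \in HKplus_zmod) Quotient.idealrBE.
by split=> /eqP.
Qed.

Lemma bar_repr (x : Hbar) : bar (repr (x : Quotient.quot HKplus_zmod)) = x.
Proof. exact: reprK. Qed.

Lemma barD : {morph bar : g h / g + h}.
Proof. by move=> g h; rewrite /bar !piE. Qed.

Definition Hbar_scale (c : k) (x : Hbar) : Hbar :=
  bar (c *: repr (x : Quotient.quot HKplus_zmod)).

Lemma Hbar_scaleE c h : Hbar_scale c (bar h) = bar (c *: h).
Proof.
by apply/bar_eq; rewrite -scalerBr; apply/HKplusZ/bar_eq; rewrite bar_repr.
Qed.

Lemma HbarP (x : Hbar) : exists h, x = bar h.
Proof. by exists (repr (x : Quotient.quot HKplus_zmod)); rewrite bar_repr. Qed.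

Lemma Hbar_scaleA a b x : Hbar_scale a (Hbar_scale b x) = Hbar_scale (a * b) x.
Proof. by case: (HbarP x) => h ->; rewrite !Hbar_scaleE scalerA. Qed.
Lemma Hbar_scale1 : left_id 1 Hbar_scale.
Proof. by move=> x; case: (HbarP x) => h ->; rewrite Hbar_scaleE scale1r. Qed.
Lemma Hbar_scaleDr : right_distributive Hbar_scale +%R.
Proof.
move=> a x y; case: (HbarP x) => h ->; case: (HbarP y) => g ->.
by rewrite -barD !Hbar_scaleE scalerDr barD.
Qed.
Lemma Hbar_scaleDl x : {morph Hbar_scale^~ x : a b / a + b}.
Proof.
by move=> a b; case: (HbarP x) => h ->; rewrite !Hbar_scaleE scalerDl barD.
Qed.

HB.instance Definition _ := GRing.Zmodule_isLmodule.Build k Hbar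
  Hbar_scaleA Hbar_scale1 Hbar_scaleDr Hbar_scaleDl.

Lemma barZ c h : bar (c *: h) = c *: bar h.
Proof. by rewrite -Hbar_scaleE. Qed.

Lemma bar_incl h x : bar (h * i x) = counit x *: bar h.
Proof.
rewrite -barZ; apply/bar_eq/HKplusP; exists [:: (h, x - (counit x)%:A)].
split=> [p|]; first by rewrite inE => /eqP -> /=;
  rewrite raddfB /= counit_alg subrr.
by rewrite big_seq1 /= raddfB /= rmorph_alg mulrBr -scalerAr mulr1.
Qed.

Section Convolution.
Variables mu nu : {scalar Hbar}.

Definition conv_gen (a b : H) : k := mu (bar a) * nu (bar b).

Lemma conv_bal : balancedk conv_gen.
Proof.
rewrite /conv_gen; split=> [b a a'|a b b'|a c b].
- by rewrite barD linearD mulrDl.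
- by rewrite barD linearD mulrDr.
- by rewrite !barZ !linearZ /= mulrCA mulrA.
Qed.

Definition conv_lift (h : H) : k := tsumk conv_gen (coprod h).

Lemma conv_liftD : {morph conv_lift : g h / g + h}.
Proof. by move=> g h; rewrite /conv_lift linearD (tsumkD conv_bal). Qed.

Lemma conv_lift0 : conv_lift 0 = 0.
Proof. by rewrite /conv_lift linear0 (tsumk0 conv_bal). Qed.

Lemma conv_tsumk (V U : lmodType k) (f : V -> U -> tensk H H) t :
  tsumk conv_gen (tsumk f t) = tsumk (fun a b => tsumk conv_gen (f a b)) t.
Proof. exact: (tsumk_morph _ _ (tsumk0 conv_bal) (tsumkD conv_bal)). Qed.

Lemma counit_bal (c : k) : balancedk (fun a b : K => c * (counit a * counit b)).
Proof.
split=> [b a a'|a b b'|a r b].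
- by rewrite raddfD mulrDl mulrDr.
- by rewrite raddfD !mulrDr.
- by rewrite !linearZ /=; congr (_ * _); rewrite mulrCA mulrA.
Qed.

Lemma conv_lift_incl h x : conv_lift (h * i x) = conv_lift h * counit x.
Proof.
rewrite /conv_lift coprodM incl_coprod conv_tsumk.
transitivity (tsumk (fun a b => conv_gen a b * counit x) (coprod h)); last first.
  by rewrite /tsumk /tsum mulr_suml.
apply: eq_tsumk => a b.
pose F (c d : H) : tensk H H := purek (a * c) (b * d).
have bF : balancedk F.
  split=> [d c c'|c d d'|c r d]; rewrite /F.
  - by rewrite mulrDr; apply: pureDl.
  - by rewrite mulrDr; apply: pureDr.
  - by rewrite -!scalerAr; apply: pure_bal.
rewrite (tsumk_morph _ _ (tsumk0 bF) (tsumkD bF)) conv_tsumk.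
transitivity (tsumk (fun c d => conv_gen a b * (counit c * counit d)) (coprod x)).
  apply: eq_tsumk => c d; rewrite (tsumk_pure bF) (tsumk_pure conv_bal).
  by rewrite /conv_gen !bar_incl !linearZ /= mulrACA mulrC.
rewrite -{2}[x]counitl /tsumk /tsum raddf_sum mulr_sumr.
by apply: eq_bigr => p _; rewrite /= linearZ.
Qed.

Lemma conv_lift_HKplus h : h \in I -> conv_lift h = 0.
Proof.
move=> /HKplusP[s [s0 ->]]; rewrite (big_morph _ conv_liftD conv_lift0).
rewrite big_seq big1 // => p ps.
by rewrite conv_lift_incl s0 // mulr0.
Qed.

Definition conv_fun (x : Hbar) : k := conv_lift (repr (x : Quotient.quot HKplus_zmod)).

Lemma conv_funE h : conv_fun (bar h) = conv_lift h.
Proof.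
have : repr (bar h : Quotient.quot HKplus_zmod) - h \in I by apply/bar_eq; rewrite bar_repr.
move=> /conv_lift_HKplus h0.
by rewrite /conv_fun -[repr _](subrK h) conv_liftD h0 add0r.
Qed.

Lemma conv_linear : scalar conv_fun.
Proof.
move=> c x y; case: (HbarP x) => h ->; case: (HbarP y) => g ->.
rewrite -barZ -barD !conv_funE conv_liftD; congr (_ + _).
rewrite /conv_lift linearZ /=; move: (coprod h) => {h}.
apply: tens_ext => [t u|t u|a b].
- by rewrite scalerDr (tsumkD conv_bal).
- by rewrite (tsumkD conv_bal) mulrDr.
rewrite -/(purek a b) purekZl !(tsumk_pure conv_bal).
by rewrite /conv_gen barZ linearZ /= mulrA.
Qed.

(* The convolution product of the dual of H / H K^+. *)
Definition conv : {scalar Hbar} :=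
  HB.pack conv_fun (GRing.isLinear.Build _ _ _ _ conv_fun conv_linear).

Lemma convE h :
  conv (bar h) = tsumk (fun a b => mu (bar a) * nu (bar b)) (coprod h).
Proof. exact: conv_funE. Qed.
End Convolution.

Definition conv_aug (mu : {scalar Hbar}) : k := mu (bar 1).

Definition right_integral (la : {scalar Hbar}) : Prop :=
  forall mu : {scalar Hbar}, conv la mu =1 (fun x => la x * conv_aug mu).

Definition right_integral_type : Prop :=
  exists (la : {scalar Hbar}) (La : H) (chi : {lrmorphism K -> k | *%R}),
  [/\ exists x, la x <> 0,
      right_integral la,
      forall h : H, la (bar (La * h)) = counit h &
      forall (x : K) (h : H), la (bar (i x * h)) = chi x * la (bar h)].
End Quotient.

Definition finitely_generated (R : nzRingType) (P : lmodType R) : Prop :=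
  exists (n : nat) (f : {linear 'rV[R]_n -> P}), forall x, exists r, f r = x.

Definition projective (R : nzRingType) (P : lmodType R) : Prop :=
  forall (M N : lmodType R) (f : {linear M -> N}) (g : {linear P -> N}),
    (forall y, exists x, f x = y) ->
    exists h : {linear P -> M}, forall p, f (h p) = g p.

Section Frobenius.
Variables (k : fieldType) (K H : hopfType k) (i : hopfExt K H).

Definition left_module : lmodType K := restr i (H^o : lmodType H).

(* k-linearity follows: c%:A in K is mapped to c%:A in H. *)
Definition bimodule_map (tr : H -> K) : Prop :=
  {morph tr : g h / g + h} /\
  forall (x y : K) (h : H), tr (i x * h * i y) = x * tr h * y.

(* h |-> tr (_ * h) is a bijection from H to the left K-linear maps H -> K. *)
Definition frobenius_morphism (tr : H -> K) : Prop :=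
  bimodule_map tr /\
  forall f : {linear left_module -> K^o},
    exists! h : H, forall g : H, tr (g * h) = f g.

Definition frobenius_extension : Prop :=
  [/\ finitely_generated left_module, projective left_module &
      exists tr : H -> K, frobenius_morphism tr].

Definition dual_bases (tr : H -> K) (n : nat) (hs ds : 'I_n -> H) : Prop :=
  forall h : H, h = \sum_j i (tr (h * ds j)) * hs j /\
                h = \sum_j ds j * i (tr (hs j * h)).

Definition IndH : functor (HMod K) (HMod H) := Ind i.

Section Structure.
Variables (tr : H -> K) (n : nat) (hs ds : 'I_n -> H).

Definition lax_formula (L : lax_structure IndH) : Prop :=
  (forall (V U : lmodType K) (h g : H) (v : V) (u : U),
    (lax2 L V U : {linear tmod (indm i V) (indm i U) -> indm i (tmod V U)})
      (puret (puri i h v) (puri i g u))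
    = \sum_j puri i (ds j)
        (tsumk (fun a b => puret (tr (a * h) *: v) (tr (b * g) *: u))
           (coprod (hs j)))) /\
  (lax0 L : {linear unitm H -> indm i (unitm K)}) (unit_el H 1)
  = \sum_j puri i (ds j) (unit_el K (counit (hs j))).

Definition oplax_formula (L : oplax_structure IndH) : Prop :=
  (forall (V U : lmodType K) (h : H) (v : V) (u : U),
    (oplax2 L V U : {linear indm i (tmod V U) -> tmod (indm i V) (indm i U)})
      (puri i h (puret v u))
    = tsumk (fun a b => puret (puri i a v) (puri i b u)) (coprod h)) /\
  forall h : H,
    (oplax0 L : {linear indm i (unitm K) -> unitm H}) (puri i h (unit_el K 1))
    = unit_el H (counit h).
End Structure.

End Frobenius.

Definition finite_dimensional (k : fieldType) (H : hopfType k)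
    (V : lmodType H) : Prop :=
  exists n : nat, inhabited (Vector.axiom n (restr (in_alg H) V)).

(* Main.v *)
Require Import Defs.
From HB Require Import structures.
From mathcomp Require Import all_boot all_order all_algebra.
From mathcomp Require Import boolp classical_sets.

(* Write [la] for the integral, [La] for the element with [la (La h) = eps h]
   and put [E h = la(h_1) h_2], a right H-comodule map H -> H which is right
   K-linear and left K-linear up to the twist [beta k = chi(k_1) k_2].

   Let [tr0] be any Frobenius morphism with dual bases [(h_j, d_j)].  The
   integral property gives [E h tr0 d = tr0 (E h d)], so that
   [E h = sum_j E(d_j) tr0(h_j h) = tr0 (u h)] with [u = sum_j E(d_j) h_j]; in
   particular E takes values in K.  As [S^-1(La_2) E(La_1 h) = h], the element
   u has a right inverse, so [eps u <> 0], and applying [eps] to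
   [u k = beta(k) u] yields [chi = eps].  Hence E is a K-bimodule map and, with
   the dual bases [La_1], [S^-1(La_2)], a Frobenius morphism [tr] satisfying
   [tr(h)_1 (x) tr(h)_2 = tr(h_1) (x) h_2].

   For such a [tr] let [ev : Ind V -> V] send [h (x) v] to [tr(h) v].  The lax
   structure is determined by [ev o lax = ev (x) ev], the oplax structure by
   its values on [1 (x) v], and the comodule property gives
   [lax ((1 (x) v) (x) q) = 1 (x) (v (x) ev q)].  Since
   [Ind V (x) W] is generated by the elements [(1 (x) v) (x) w], the Frobenius
   identities only have to be checked there. *)

Set Implicit Arguments.
Unset Strict Implicit.
Unset Printing Implicit Defensive.

Import GRing.Theory.
Local Open Scope ring_scope.

(** * Sweedler calculus *)

Notation "\sw_ ( a , b <- h ) F" := (tsumk (fun a b => F) (coprod h))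
  (at level 41, a name, b name, h at level 60, F at level 41,
   format "\sw_ ( a ,  b  <-  h )  F") : ring_scope.

(** A scalar action stripped down to additivity of each scalar. One set of Sweedler rules then
    serves sums with values in [k]-spaces and in modules over a [k]-algebra alike. *)
Record scaling (k : fieldType) (W : zmodType) := Scaling {
  scal :> k -> W -> W;
  scalD : forall r, {morph scal r : x y / x + y} }.

Definition scK (k : fieldType) (W : lmodType k) : scaling k W :=
  Scaling (fun r => scalerDr r : {morph (fun w : W => r *: w) : x y / x + y}).

Definition scM (k : fieldType) (A : algType k) (W : lmodType A) : scaling k W :=
  Scaling (fun r : k =>
    scalerDr r%:A : {morph (fun w : W => (r%:A : A) *: w) : x y / x + y}).

(* [slin] is k-linearity for a target that is a k-module ([scK]) or a module
   over a k-algebra ([scM]). *)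
Record slin (k : fieldType) (V : lmodType k) (W : zmodType)
    (s : scaling k W) (f : V -> W) : Prop := Slin {
  slinD : {morph f : x y / x + y};
  slinZ : forall r x, f (r *: x) = s r (f x) }.

Section SLin.
Variables (k : fieldType) (V : lmodType k).

Lemma scal0 (W : zmodType) (s : scaling k W) r : s r 0 = 0.
Proof. by apply: (addrI (s r 0)); rewrite -scalD !addr0. Qed.

Lemma additive0 (U W : zmodType) (f : U -> W) :
  {morph f : x y / x + y} -> f 0 = 0.
Proof. by move=> fD; apply: (addrI (f 0)); rewrite -fD !addr0. Qed.

Lemma slin_id : slin (scK V) id.
Proof. by []. Qed.

Lemma slin_comp (U : lmodType k) (W : zmodType) (s : scaling k W)
    (f : U -> W) (g : V -> U) :
  slin s f -> slin (scK U) g -> slin s (fun x => f (g x)).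
Proof.
by move=> [fD fZ] [gD gZ]; split=> [x y|r x]; rewrite ?gD ?gZ ?fD ?fZ.
Qed.

Lemma slin_linear (U W : lmodType k) (g : {linear U -> W}) (f : V -> U) :
  slin (scK U) f -> slin (scK W) (fun x => g (f x)).
Proof.
by case=> fD fZ; split=> [x y|r x]; rewrite ?fD ?fZ /= ?linearD ?linearZ.
Qed.

Lemma slin_lrA (A B : algType k) (g : {lrmorphism A -> B}) (f : V -> A) :
  slin (scK A) f -> slin (scK B) (fun x => g (f x)).
Proof.
by case=> fD fZ; split=> [x y|r x]; rewrite ?fD ?fZ /= ?raddfD ?linearZ.
Qed.

Lemma slin_bar (K H : hopfType k) (i : hopfExt K H) (f : V -> H) :
  slin (scK H) f -> slin (scK (Hbar i)) (fun x => bar i (f x)).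
Proof.
by case=> fD fZ; split=> [x y|r x]; rewrite ?fD ?fZ /= ?barD ?barZ.
Qed.

Lemma slin_mull (A : algType k) (f : V -> A) b :
  slin (scK A) f -> slin (scK A) (fun x => f x * b).
Proof.
by case=> fD fZ; split=> [x y|r x]; rewrite ?fD ?fZ /= ?mulrDl -?scalerAl.
Qed.

Lemma slin_mulr (A : algType k) (f : V -> A) b :
  slin (scK A) f -> slin (scK A) (fun x => b * f x).
Proof.
by case=> fD fZ; split=> [x y|r x]; rewrite ?fD ?fZ /= ?mulrDr -?scalerAr.
Qed.

Lemma slin_scalel (W : lmodType k) (f : V -> k) (w : W) :
  slin (scK k^o) f -> slin (scK W) (fun x => f x *: w).
Proof.
by case=> fD fZ; split=> [x y|r x]; rewrite ?fD ?fZ /= ?scalerDl // scalerA.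
Qed.

Lemma slin_act (A : algType k) (W : lmodType A) (f : V -> A) (w : W) :
  slin (scK A) f -> slin (scM W) (fun x => f x *: w).
Proof.
case=> fD fZ; split=> [x y|r x]; rewrite ?fD ?fZ /= ?scalerDl //.
by rewrite -algZl.
Qed.

Lemma slin_puretl (H : hopfType k) (U W : lmodType H) (f : V -> U) (w : W) :
  slin (scM U) f -> slin (scM (tmod U W)) (fun x => puret (f x) w).
Proof.
case=> fD fZ; split=> [x y|r x]; rewrite ?fD ?fZ /= ?puretDl //.
by rewrite puretZk.
Qed.

Lemma slin_puretr (H : hopfType k) (U W : lmodType H) (f : V -> W) (u : U) :
  slin (scM W) f -> slin (scM (tmod U W)) (fun x => puret u (f x)).
Proof.
case=> fD fZ; split=> [x y|r x]; rewrite ?fD ?fZ /= ?puretDr //.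
by rewrite puretZk puret_bal.
Qed.

Lemma slin_puril (K H : hopfType k) (i : hopfExt K H) (U : lmodType K)
    (f : V -> H) (u : U) :
  slin (scK H) f ->
  slin (scM (indm i U : lmodType H)) (fun x => puri i (f x) u).
Proof.
case=> fD fZ; split=> [x y|r x]; rewrite ?fD ?fZ /= ?puriDl //.
by rewrite puriZ mulr_algl.
Qed.

Lemma slin_purir (K H : hopfType k) (i : hopfExt K H) (U : lmodType K)
    (f : V -> U) (h : H) :
  slin (scM U) f ->
  slin (scM (indm i U : lmodType H)) (fun x => puri i h (f x)).
Proof.
case=> fD fZ; split=> [x y|r x]; rewrite ?fD ?fZ /= ?puriDr //.
by rewrite -puri_bal /= rmorph_alg puriZ mulr_algl mulr_algr.
Qed.

Lemma slin_tsum (W : zmodType) (s : scaling k W) (A B : lmodType k)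
    (f : V -> A -> B -> W) t :
  (forall a b, slin s (fun x => f x a b)) ->
  slin s (fun x => tsumk (f x) t).
Proof.
move=> fl; split=> [x y|r x].
  by rewrite -tsumk_fD; apply: eq_tsumk => a b; case: (fl a b).
rewrite (tsumk_morph (g := s r)) ?scal0 //; last exact: scalD.
by apply: eq_tsumk => a b; case: (fl a b).
Qed.
End SLin.

Section Bilinear.
Variables (k : fieldType) (V U : lmodType k).

Lemma slin_bal (W : zmodType) (s : scaling k W) (f : V -> U -> W) :
  (forall b, slin s (fun a => f a b)) -> (forall a, slin s (f a)) ->
  balancedk f.
Proof.
move=> fl fr; split=> [b|a|a r b]; first by case: (fl b).
- by case: (fr a).
- by case: (fl b) => _ ->; case: (fr a) => _ ->.
Qed.

Lemma slin_tsumk (W : zmodType) (s : scaling k W) (f : V -> U -> W) :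
  (forall b, slin s (fun a => f a b)) -> (forall a, slin s (f a)) ->
  slin s (tsumk f).
Proof.
move=> fl fr; have bf := slin_bal fl fr.
split=> [x y|r x]; first exact: tsumkD.
move: x; apply: tens_ext => [x y|x y|a b].
- by rewrite scalerDr tsumkD.
- by rewrite tsumkD // scalD.
by rewrite -/(purek a b) purekZl !tsumk_pure //; case: (fl b).
Qed.

Lemma slin_tsumt (T : lmodType k) (W : zmodType) (s : scaling k W)
    (f : V -> U -> W) (g : T -> tensk V U) :
  slin (scK (tensk V U)) g ->
  (forall b, slin s (fun a => f a b)) -> (forall a, slin s (f a)) ->
  slin s (fun x => tsumk f (g x)).
Proof.
move=> [gD gZ] fl fr; have [fD fZ] := slin_tsumk fl fr.
by split=> [x y|r x]; rewrite ?gD ?gZ ?fD ?fZ.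
Qed.

Lemma slin_pure (W : zmodType) (s : scaling k W) (f : V -> U -> W) a b :
  (forall b, slin s (fun a => f a b)) -> (forall a, slin s (f a)) ->
  tsumk f (purek a b) = f a b.
Proof. by move=> fl fr; apply: tsumk_pure; apply: slin_bal fl fr. Qed.

Lemma tsumk_tsumk (A B : lmodType k) (W : zmodType) (s : scaling k W)
    (f : V -> U -> W) (g : A -> B -> tensk V U) t :
  (forall b, slin s (fun a => f a b)) -> (forall a, slin s (f a)) ->
  tsumk f (tsumk g t) = tsumk (fun a b => tsumk f (g a b)) t.
Proof.
move=> fl fr; have bf := slin_bal fl fr.
by apply: tsumk_morph; [apply: tsumk0|apply: tsumkD].
Qed.

Lemma slin_sum (T : lmodType k) (W : zmodType) (s : scaling k W)
    (f : T -> W) (g : V -> U -> T) t :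
  slin s f -> f (tsumk g t) = tsumk (fun a b => f (g a b)) t.
Proof. by case=> fD _; apply: tsumk_morph => //; apply: additive0. Qed.

Lemma additive_sum (T W : zmodType) (f : T -> W) (g : V -> U -> T) t :
  {morph f : x y / x + y} -> f (tsumk g t) = tsumk (fun a b => f (g a b)) t.
Proof. by move=> fD; apply: tsumk_morph => //; apply: additive0. Qed.
End Bilinear.

Ltac slin_hyp := match goal with
  | h : forall b, slin ?s (fun a => ?f a b) |-
      slin ?s (fun x => ?f (@?g x) ?c) =>
      refine (slin_comp (f := fun a => f a c) (g := g) (h c) _)
  | h : forall a, slin ?s (?f a) |- slin ?s (fun x => ?f ?c (@?g x)) =>
      refine (slin_comp (f := f c) (g := g) (h c) _)
  | h : slin ?s ?f |- slin ?s (fun x => ?f (@?g x)) =>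
      refine (slin_comp (f := f) (g := g) h _)
  end.
Ltac slin_step := first
  [ assumption | apply: slin_id
  | apply: slin_tsumt | apply: slin_tsum
  | apply: slin_mull | apply: slin_mulr
  | apply: slin_puretl | apply: slin_puretr
  | apply: slin_puril | apply: slin_purir
  | apply: slin_scalel | apply: slin_act | apply: slin_bar | apply: slin_lrA
  | apply: slin_linear | slin_hyp ].
(** Every Sweedler rule asks for linearity in each leg. The tactic settles this by peeling the
    outermost operation until the bound variable is reached. *)
Ltac slin := intros; rewrite /=; repeat (slin_step; intros; rewrite /=).

Section Sweedler.
Variables (k : fieldType) (H : hopfType k).
Implicit Types (x y h : H).

(** The trilinear [f] induces a map [G] on the nested tensor product, and both sums are [G] applied
    to the two sides of [coprodA]. *)
Lemma sw_assoc (W : zmodType) (s : scaling k W) (f : H -> H -> H -> W) h :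
  (forall b c, slin s (fun a => f a b c)) ->
  (forall a c, slin s (fun b => f a b c)) ->
  (forall a b, slin s (f a b)) ->
  \sw_(a, b <- h) \sw_(a1, a2 <- a) f a1 a2 b
  = \sw_(a, b <- h) \sw_(b1, b2 <- b) f a b1 b2.
Proof.
move=> f1 f2 f3; pose G a (t : tensk H H) := tsumk (f a) t.
have G1 t : slin s (fun a => G a t) by apply: slin_tsum => a b; apply: f1.
have G2 a : slin s (G a) by apply: slin_tsumk => [b|b]; [apply: f2|apply: f3].
have := congr1 (tsumk G) (coprodA h).
rewrite !(tsumk_tsumk _ _ G1 G2) => E.
transitivity (\sw_(a, b <- h) tsumk G (\sw_(a1, a2 <- a) purek a1 (purek a2 b))).
  apply: eq_tsumk => a b; rewrite (tsumk_tsumk _ _ G1 G2).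
  apply: eq_tsumk => a1 a2; rewrite (slin_pure _ _ G1 G2).
  by rewrite /G (slin_pure _ _ (f2 a1) (f3 a1)).
by rewrite E; apply: eq_tsumk => a b; rewrite (slin_pure _ _ G1 G2).
Qed.

Lemma sw_counitl (W : zmodType) (s : scaling k W) (f : H -> W) h :
  slin s f -> \sw_(a, b <- h) f (counit a *: b) = f h.
Proof. by move=> fl; rewrite -(slin_sum _ _ fl) counitl. Qed.

Lemma sw_counitr (W : zmodType) (s : scaling k W) (f : H -> W) h :
  slin s f -> \sw_(a, b <- h) f (counit b *: a) = f h.
Proof. by move=> fl; rewrite -(slin_sum _ _ fl) counitr. Qed.

Lemma sw_antil (W : zmodType) (s : scaling k W) (f : H -> W) h :
  slin s f -> \sw_(a, b <- h) f (antipode a * b) = s (counit h) (f 1).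
Proof. by move=> fl; rewrite -(slin_sum _ _ fl) antipodel; case: fl => _ ->. Qed.

Lemma sw_antir (W : zmodType) (s : scaling k W) (f : H -> W) h :
  slin s f -> \sw_(a, b <- h) f (a * antipode b) = s (counit h) (f 1).
Proof. by move=> fl; rewrite -(slin_sum _ _ fl) antipoder; case: fl => _ ->. Qed.

Lemma sw_mul (W : zmodType) (s : scaling k W) (f : H -> H -> W) x y :
  (forall b, slin s (fun a => f a b)) -> (forall a, slin s (f a)) ->
  \sw_(a, b <- x * y) f a b = \sw_(a, b <- x) \sw_(c, d <- y) f (a * c) (b * d).
Proof.
move=> f1 f2; rewrite coprodM (tsumk_tsumk _ _ f1 f2); apply: eq_tsumk => a b.
rewrite (tsumk_tsumk _ _ f1 f2); apply: eq_tsumk => c d.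
by rewrite (slin_pure _ _ f1 f2).
Qed.

Lemma sw_exch (W : zmodType) (f : H -> H -> H -> H -> W) x y :
  \sw_(a, b <- x) \sw_(c, d <- y) f a b c d
  = \sw_(c, d <- y) \sw_(a, b <- x) f a b c d.
Proof. exact: tsumk_exch. Qed.

(** The argument 1 is expanded as [h_2 S(h_3)]; the factor [eps(h_2)] this costs is absorbed by the
    counit axiom. Antipode computations start with this insertion. *)
Lemma sw_insr (W : zmodType) (s : scaling k W) (f : H -> H -> W) h :
  (forall b, slin s (fun a => f a b)) -> (forall a, slin s (f a)) ->
  f h 1 = \sw_(a, b <- h) \sw_(b1, b2 <- b) f a (b1 * antipode b2).
Proof.
move=> f1 f2; rewrite -(sw_counitr h (f1 1)); apply: eq_tsumk => a b.
by rewrite (sw_antir _ (f2 a)); case: (f1 1) => _ ->.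
Qed.

Lemma sw_insr' (W : zmodType) (s : scaling k W) (f : H -> H -> W) h :
  (forall b, slin s (fun a => f a b)) -> (forall a, slin s (f a)) ->
  f h 1 = \sw_(a, b <- h) \sw_(b1, b2 <- b) f a (antipode b1 * b2).
Proof.
move=> f1 f2; rewrite -(sw_counitr h (f1 1)); apply: eq_tsumk => a b.
by rewrite (sw_antil _ (f2 a)); case: (f1 1) => _ ->.
Qed.

(** Uniqueness of convolution inverses, written out: [S(xy) = S(x_1 y_1) x_2 y_2 S(y_3) S(x_3)],
    where the first two factors collapse to [eps(x_1 y_1)]. *)
Lemma antipodeM x y : antipode (x * y) = antipode y * antipode x.
Proof.
pose F (b d z w : H) : H := antipode z * w * (antipode d * antipode b).
have E e b d : \sw_(z, w <- e) F b d z w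
   = counit e *: (antipode d * antipode b).
  rewrite (sw_antil (s := scK H)
    (f := fun z => z * (antipode d * antipode b))) ?mul1r //.
  slin.
transitivity (\sw_(a, b <- x) \sw_(c, d <- y) 
   \sw_(a1, a2 <- a) \sw_(c1, c2 <- c) F b d (a1 * c1) (a2 * c2)).
  rewrite -[LHS]mulr1.
  rewrite (sw_insr (s := scK H)
    (f := fun z w => antipode (z * y) * w)); try slin.
  rewrite -(sw_assoc (s := scK H)
    (f := fun a b c => antipode (a * y) * (b * antipode c))); try slin.
  apply: eq_tsumk => a b; rewrite sw_exch; apply: eq_tsumk => a1 a2.
  pose f z w := antipode (a1 * z) * (a2 * (w * antipode b)).
  rewrite -[antipode b]mul1r -/(f y 1).
  rewrite (sw_insr (s := scK H)); try slin.
  rewrite -(sw_assoc (s := scK H)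
    (f := fun c d e => f c (d * antipode e))); try slin.
  apply: eq_tsumk => c d; apply: eq_tsumk => c1 c2.
  by rewrite /f /F !mulrA.
transitivity (\sw_(a, b <- x) \sw_(c, d <- y)
  (antipode (counit c *: d) * antipode (counit a *: b))).
  apply: eq_tsumk => a b; apply: eq_tsumk => c d.
  rewrite -(sw_mul (s := scK H)); try slin.
  rewrite E rmorphM !linearZ /= -scalerAl -scalerAr scalerA.
  by rewrite mulrC.
transitivity (\sw_(a, b <- x) (antipode y * antipode (counit a *: b))).
  apply: eq_tsumk => a b.
  rewrite (sw_counitl (s := scK H)
    (f := fun z => antipode z * antipode (counit a *: b))) //.
  slin.
rewrite (sw_counitl (s := scK H) (f := fun z => antipode y * antipode z)) //.
slin.
Qed.
End Sweedler.

(** * Coproducts of the antipode and of its inverse *)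

Section Antipode.
Variables (k : fieldType) (H : hopfType k).
Implicit Types (x y h : H).

(** Multiply the legs of the coproduct of [S(h_1)] on the right by [h_2 S(h_5)] and [h_3 S(h_4)].
    Regrouping produces the coproduct of [S(h_1) h_2], which collapses to a counit. *)
Lemma sw_antipode (W : zmodType) (s : scaling k W) (f : H -> H -> W) h :
  (forall b, slin s (fun a => f a b)) -> (forall a, slin s (f a)) ->
  \sw_(a, b <- antipode h) f a b = \sw_(a, b <- h) f (antipode b) (antipode a).
Proof.
move=> f1 f2.
pose G (a u v : H) := \sw_(c, d <- antipode a) f (c * u) (d * v).
pose P (u v z : H) := \sw_(c, d <- z) f (c * antipode v) (d * antipode u).
have E t u v : \sw_(z, w <- t) P u v (antipode z * w)
    = s (counit t) (f (antipode v) (antipode u)).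
  rewrite (sw_antil (s := s)); last by rewrite /P; slin.
  by rewrite /P coprod1 (slin_pure (s := s)) ?mul1r //; slin.
transitivity (G h 1 1).
  by apply: eq_tsumk => a b; rewrite !mulr1.
rewrite (sw_insr (s := s) (f := fun a u => G a u 1)); try by rewrite /G; slin.
transitivity (\sw_(a, b <- h) \sw_(r, t <- b) \sw_(u, v <- t)
  P u v (antipode a * r)).
  apply: eq_tsumk => a b.
  transitivity (\sw_(b1, v <- b) \sw_(r, u <- b1) P u v (antipode a * r)).
    apply: eq_tsumk => b1 b2.
    rewrite (sw_insr (s := s) (f := fun p q => G a (p * antipode b2) q));
      try by rewrite /G; slin.
    rewrite -(sw_assoc (s := s)
      (f := fun p q t => G a (p * antipode b2) (q * antipode t)));
      try by rewrite /G; slin.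
    apply: eq_tsumk => r u.
    rewrite /G /P (sw_mul (s := s)); try slin.
    rewrite sw_exch; apply: eq_tsumk => c d; apply: eq_tsumk => p q.
    by rewrite !mulrA.
  rewrite (sw_assoc (s := s) (f := fun r u v => P u v (antipode a * r))) //;
    by rewrite /P; slin.
rewrite -(sw_assoc (s := s)
  (f := fun a r t => \sw_(u, v <- t) P u v (antipode a * r)));
  try by rewrite /P; slin.
pose Q t := \sw_(u, v <- t) f (antipode v) (antipode u).
rewrite -[RHS]/(Q h) -(sw_counitl (s := s) (f := Q)); last by rewrite /Q; slin.
apply: eq_tsumk => a t.
transitivity (\sw_(u, v <- t) \sw_(z, w <- a) P u v (antipode z * w)).
  exact: tsumk_exch.
have [_ QZ] : slin s Q by rewrite /Q; slin.
rewrite QZ /Q (additive_sum _ _ (scalD s _)).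
by apply: eq_tsumk => u v; rewrite E.
Qed.

Lemma antipode1 : antipode (1 : H) = 1.
Proof.
have := antipodel (1 : H).
by rewrite coprod1 (slin_pure (s := scK H)) ?mulr1 ?rmorph1 ?scale1r //; slin.
Qed.

Variable T : H -> H.
Hypotheses (KT : cancel antipode T) (TK : cancel T antipode).

Lemma antipodeV_lin : slin (scK H) T.
Proof.
split=> [x y|r x]; apply: (can_inj KT); rewrite ?linearD ?linearZ /= !TK //.
Qed.

(** Applying [S], which reverses products, turns this into the antipode axiom. *)
Lemma sw_antipodeV_mul h : \sw_(a, b <- h) (T b * a) = (counit h)%:A.
Proof.
apply: (can_inj KT); rewrite linearZ /= antipode1.
rewrite (slin_sum (s := scK H)) -?antipodel; last slin.
by apply: eq_tsumk => a b; rewrite antipodeM TK.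
Qed.

Lemma sw_antipodeV (W : zmodType) (s : scaling k W) (f : H -> H -> W) h :
  (forall b, slin s (fun a => f a b)) -> (forall a, slin s (f a)) ->
  \sw_(a, b <- T h) f a b = \sw_(a, b <- h) f (T b) (T a).
Proof.
move=> f1 f2; rewrite -{2}[h]TK (sw_antipode (s := s)).
- by apply: eq_tsumk => a b; rewrite !KT.
- by move=> b; apply: slin_comp (f2 _) antipodeV_lin.
- by move=> a; apply: slin_comp (f1 _) antipodeV_lin.
Qed.
End Antipode.

(** * Frobenius morphisms *)

Lemma sw_incl (k : fieldType) (K H : hopfType k) (i : hopfExt K H)
    (W : zmodType) (s : scaling k W) (f : H -> H -> W) (x : K) :
  (forall b, slin s (fun a => f a b)) -> (forall a, slin s (f a)) ->
  \sw_(a, b <- i x) f a b = \sw_(a, b <- x) f (i a) (i b).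
Proof.
move=> f1 f2; rewrite incl_coprod (tsumk_tsumk _ _ f1 f2).
by apply: eq_tsumk => a b; rewrite (slin_pure _ _ f1 f2).
Qed.

Section FrobeniusMorphism.
Variables (k : fieldType) (K H : hopfType k) (i : hopfExt K H) (tr : H -> K).
Hypothesis trF : frobenius_morphism i tr.

Lemma frob_lin : slin (scK K) tr.
Proof.
case: trF => [[trD trM] _]; split=> // r x.
have := trM r%:A 1 x; rewrite !rmorph1 !mulr1 mulr_algl /= => <-.
by rewrite /= rmorph_alg mulr_algl.
Qed.

Lemma frobMl x h : tr (i x * h) = x * tr h.
Proof.
by case: trF => [[_ trM] _]; have := trM x 1 h; rewrite rmorph1 !mulr1.
Qed.

Lemma frobMr x h : tr (h * i x) = tr h * x.
Proof.
by case: trF => [[_ trM] _]; have := trM 1 x h; rewrite rmorph1 !mul1r.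
Qed.

(** Both elements represent the same left [K]-linear map, and the Frobenius property makes the
    representative unique. *)
Lemma frob_inj h h' : (forall g, tr (g * h) = tr (g * h')) -> h = h'.
Proof.
move=> E; case: trF => [[trD trM] trB].
have lf : linear (fun g : left_module i => tr ((g : H) * h') : K^o).
  move=> x g g'; rewrite mulrDl trD; congr (_ + _).
  by rewrite -[X in tr X]mulrA frobMl.
have [g [_ gu]] := trB (mk_linear lf).
by rewrite -(gu h) // -(gu h').
Qed.

Hypotheses (fgH : finitely_generated (left_module i))
  (pjH : projective (left_module i)).

(** Projectivity splits a surjection from a free module. The [hs] are the images of the standard
    basis, and the [ds] represent the coordinates of the splitting through [tr]. *)
Lemma frob_dual_bases : exists n (hs ds : 'I_n -> H), dual_bases i tr hs ds.
Proof.
case: fgH => n [f fs].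
have [g gf] := pjH (lid _) fs.
have lg j : linear (fun h : left_module i => g h 0 j : K^o).
  by move=> x h h'; rewrite linearP !mxE.
have /(_ _)/cid dsP j := proj2 trF (mk_linear (lg j)).
pose hs j : H := f (delta_mx 0 j); pose ds j := sval (dsP j).
have dsE j h : tr (h * ds j) = g h 0 j by case: (svalP (dsP j)) => ->.
have E h : h = \sum_j i (tr (h * ds j)) * hs j.
  rewrite -{1}[h]gf {1}(row_sum_delta (g h)) linear_sum.
  by apply: eq_bigr => j _; rewrite linearZ dsE.
exists n, hs, ds => h; split=> //.
(* The second identity is checked after applying [tr (x * _)], where it follows from the first. *)
have [trD _] := frob_lin.
apply: frob_inj => x; rewrite {1}[x]E mulr_suml mulr_sumr.
rewrite !(big_morph tr trD (additive0 trD)).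
by apply: eq_bigr => j _; rewrite -mulrA frobMl mulrA frobMr.
Qed.
End FrobeniusMorphism.

Section DualBases.
Variables (k : fieldType) (K H : hopfType k) (i : hopfExt K H) (tr : H -> K).
Variables (n : nat) (hs ds : 'I_n -> H).
Hypotheses (db : dual_bases i tr hs ds).

(** Nondegeneracy in the other variable than in [frob_inj]. *)
Lemma dual_bases_inj h : (forall g, tr (h * g) = 0) -> h = 0.
Proof.
move=> h0; case: (db h) => -> _.
by rewrite big1 // => j _; rewrite h0 raddf0 mul0r.
Qed.
End DualBases.

(** * The Frobenius morphism of a right integral *)

Section Integral.
Variables (k : fieldType) (K H : hopfType k) (i : hopfExt K H).
Variables (la : {scalar Hbar i}) (La : H) (chi : {lrmorphism K -> k | *%R}).
Hypotheses (la_neq0 : exists x, la x <> 0) (la_int : right_integral la).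
Hypotheses (La_la : forall h : H, la (bar i (La * h)) = counit h).
Hypotheses (chi_la : forall (x : K) (h : H),
  la (bar i (i x * h)) = chi x * la (bar i h)).
Local Notation lam h := (la (bar i h)).

Definition integral_map (h : H) : H := \sw_(a, b <- h) lam a *: b.
Local Notation E := integral_map.

Lemma integral_map_lin : slin (scK H) E.
Proof. by rewrite /E; slin. Qed.

Lemma integral_mapMr h x : E (h * i x) = E h * i x.
Proof.
rewrite /E (sw_mul (s := scK H)); try slin.
rewrite (slin_sum (s := scK H) (f := fun z => z * i x)); last slin.
apply: eq_tsumk => a b; rewrite (sw_incl i (s := scK H)); try slin.
rewrite -[RHS](sw_counitl (s := scK H) (f := fun z => lam a *: b * i z));
  last slin.
apply: eq_tsumk => c d; rewrite bar_incl !linearZ /= -!scalerAl -scalerAr.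
by rewrite !scalerA mulrC.
Qed.

Lemma integral_mapMl h x : E (i x * h) = i (\sw_(a, b <- x) chi a *: b) * E h.
Proof.
rewrite /E (sw_mul (s := scK H)); try slin.
rewrite (sw_incl i (s := scK H)); try slin.
rewrite (slin_sum (s := scK H) (f := fun z => i z * _)); last slin.
apply: eq_tsumk => a b.
rewrite (slin_sum (s := scK H) (f := fun z => i (chi a *: b) * z)); last slin.
apply: eq_tsumk => c d.
by rewrite chi_la linearZ /= -scalerAl -scalerAr scalerA.
Qed.

Lemma counit_integral_map h : counit (E h) = lam h.
Proof.
rewrite /E (slin_sum (s := scK k^o) (f := @counit _ H)); last slin.
rewrite -(sw_counitr (s := scK k^o) (f := fun z => lam z)); last slin.
by apply: eq_tsumk => a b; rewrite linearZ /= barZ linearZ /= mulrC.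
Qed.

(** [E] contracts the first leg of the coproduct only, so coassociativity makes it a right comodule
    map. *)
Lemma sw_integral_map (W : zmodType) (s : scaling k W) (f : H -> H -> W) h :
  (forall b, slin s (fun a => f a b)) -> (forall a, slin s (f a)) ->
  \sw_(a, b <- E h) f a b = \sw_(a, b <- h) f (E a) b.
Proof.
move=> f1 f2.
have fl : slin s (fun z => \sw_(a, b <- z) f a b) by slin.
rewrite /E (slin_sum _ _ fl).
transitivity (\sw_(a, b <- h) \sw_(b1, b2 <- b) f (lam a *: b1) b2).
  apply: eq_tsumk => a b; case: fl => _ ->.
  rewrite (additive_sum _ _ (scalD s _)); apply: eq_tsumk => b1 b2.
  by case: (f1 b2) => _ ->.
rewrite -(sw_assoc (s := s) (f := fun a b c => f (lam a *: b) c)); try slin.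
by apply: eq_tsumk => a b; rewrite (slin_sum _ _ (f1 b)).
Qed.

Variable T : H -> H.
Hypotheses (KT : cancel antipode T) (TK : cancel T antipode).

(** The sum is [la(La_1 h_1) S^-1(La_3) La_2 h_2]. The factor [S^-1(La_3) La_2] collapses to a
    counit, leaving [la(La h_1) h_2 = eps(h_1) h_2]. *)
Lemma integral_map_dual h : \sw_(a, b <- La) (T b * E (a * h)) = h.
Proof.
have Tl := antipodeV_lin KT TK.
pose F (u v w : H) := \sw_(c, d <- h) lam (u * c) *: (T w * (v * d)).
transitivity (\sw_(a, b <- La) \sw_(a1, a2 <- a) F a1 a2 b).
  apply: eq_tsumk => a b; rewrite /E (sw_mul (s := scK H)); try slin.
  rewrite (slin_sum (s := scK H) (f := fun z => T b * z)); last slin.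
  apply: eq_tsumk => a1 a2.
  rewrite (slin_sum (s := scK H) (f := fun z => T b * z)); last slin.
  by apply: eq_tsumk => c d; rewrite -scalerAr.
rewrite (sw_assoc (s := scK H)); try by rewrite /F; slin.
pose G u := \sw_(c, d <- h) lam (u * c) *: d.
transitivity (G La); last first.
  rewrite -[RHS]counitl; apply: eq_tsumk => c d.
  by rewrite La_la.
rewrite -(sw_counitr (s := scK H)); last by rewrite /G; slin.
apply: eq_tsumk => a b; rewrite /F [LHS]tsumk_exch.
apply: eq_tsumk => c d.
rewrite -(slin_sum (s := scK H) (f := fun z => lam (a * c) *: z)); last slin.
rewrite -scalerAl barZ linearZ /= mulrC -scalerA -[counit b *: d]mulr_algl.
rewrite -(sw_antipodeV_mul KT TK).
rewrite (slin_sum (s := scK H) (f := fun z => z * d)); last slin.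
by congr (_ *: _); apply: eq_tsumk => b1 b2; rewrite mulrA.
Qed.
End Integral.

(** A single finite family of pairs that serves all [f] at once; applied to the coproduct of [La],
    it provides the index set of the dual bases. *)
Lemma tensk_repr (k : fieldType) (V U : lmodType k) (t : tensk V U) :
  exists n (vs : 'I_n -> V) (us : 'I_n -> U), forall (W : nmodType)
    (f : V -> U -> W), tsumk f t = \sum_j f (vs j) (us j).
Proof.
pose s := repr (t : tens _ _).
exists (size s), (fun j => (nth (0, 0) s j).1), (fun j => (nth (0, 0) s j).2).
by move=> W f; rewrite /tsumk /tsum -/s (big_nth (0, 0)) big_mkord.
Qed.

(** The invariance condition makes [m] vanish on [H K^+], so it descends to the quotient. *)
Lemma Hbar_functional (k : fieldType) (K H : hopfType k) (i : hopfExt K H)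
    (m : H -> k) :
  slin (scK k^o) m -> (forall h x, m (h * i x) = m h * counit x) ->
  exists mu : {scalar Hbar i}, forall h, mu (bar i h) = m h.
Proof.
move=> [mD mZ] mi; have m0 := additive0 mD.
have mI h : h \in HKplus i -> m h = 0.
  move=> /HKplusP[s [s0 ->]]; rewrite (big_morph m mD m0) big_seq.
  rewrite big1 // => p ps.
  by rewrite mi s0 // mulr0.
pose f (x : Hbar i) := m (repr (x : Quotient.quot (HKplus_zmod i))).
have fE h : f (bar i h) = m h.
  have : repr (bar i h : Quotient.quot (HKplus_zmod i)) - h \in HKplus i.
    by apply/bar_eq; rewrite bar_repr.
  by move=> /mI h0; rewrite /f -[repr _](subrK h) mD h0 add0r.
have lf : scalar f.
  move=> c x y; case: (HbarP x) => h ->; case: (HbarP y) => g ->.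
  by rewrite -barZ -barD !fE mD mZ.
pose F : {scalar Hbar i} := HB.pack f (GRing.isLinear.Build _ _ _ _ f lf).
by exists F.
Qed.

(** Converse of [frob_dual_bases]: dual bases force nondegeneracy. *)
Lemma frobenius_morphism_dual (k : fieldType) (K H : hopfType k)
    (i : hopfExt K H) (tr : H -> K) n (hs ds : 'I_n -> H) :
  bimodule_map i tr -> dual_bases i tr hs ds -> frobenius_morphism i tr.
Proof.
move=> btr db; split=> // f; have [trD trM] := btr.
have tr0 := additive0 trD.
have [f' fE] : exists f' : H -> K, forall x, f x = f' x by exists f.
have fM x g : f' (i x * g) = x * f' g.
  by rewrite -!fE -[i x * g]/(x *: (g : left_module i)) linearZ.
have fD : {morph f' : x y / x + y} by move=> x y; rewrite -!fE; apply: raddfD.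
(* The second dual basis identity forces this representative; the first shows that it works. *)
exists (\sum_j ds j * i (f' (hs j))); split=> [g|h hE].
  rewrite fE [X in _ = f' X](proj1 (db g)).
  rewrite mulr_sumr (big_morph tr trD tr0) (big_morph _ fD (additive0 fD)).
  apply: eq_bigr => j _; rewrite fM.
  by have := trM 1 (f' (hs j)) (g * ds j); rewrite rmorph1 !mul1r mulrA.
have [_ ->] := db h; apply: eq_bigr => j _.
by rewrite hE fE.
Qed.

Section Integral.
Variables (k : fieldType) (K H : hopfType k) (i : hopfExt K H).
Variables (la : {scalar Hbar i}) (La : H) (chi : {lrmorphism K -> k | *%R}).
Hypotheses (la_neq0 : exists x, la x <> 0) (la_int : right_integral la).
Hypotheses (La_la : forall h : H, la (bar i (La * h)) = counit h).
Hypotheses (chi_la : forall (x : K) (h : H),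
  la (bar i (i x * h)) = chi x * la (bar i h)).
Local Notation lam h := (la (bar i h)).
Local Notation E := (integral_map la).
Variable T : H -> H.
Hypotheses (KT : cancel antipode T) (TK : cancel T antipode).
Let Tl := antipodeV_lin KT TK.

Variables (tr0 : H -> K) (n : nat) (hs ds : 'I_n -> H).
Hypotheses (trF : frobenius_morphism i tr0) (db : dual_bases i tr0 hs ds).
Let trL := frob_lin trF.
Let trM := frobMl trF.
Let trMr := frobMr trF.

(** The right integral identity, transported from functionals on [Hbar] to functionals on [H] that
    descend to it. *)
Lemma integral_functional (m : H -> k) h :
  slin (scK k^o) m -> (forall h x, m (h * i x) = m h * counit x) ->
  \sw_(a, b <- h) (lam a * m b) = lam h * m 1.
Proof.
move=> ml mi; have [mu muE] := Hbar_functional ml mi.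
have := la_int mu (bar i h); rewrite convE /conv_aug muE => <-.
by apply: eq_tsumk => a b; rewrite muE.
Qed.

(* [x |-> x_1 tr0(S(x_2) g)] kills [H K^+], so it only sees the class of [x] in
   [Hbar], on which the functionals [eps tr0(h_j -)] give coordinates. *)
Definition twist (g x : H) : H :=
  \sw_(a, b <- x) (a * i (tr0 (antipode b * g))).

Lemma twist_lin g : slin (scK H) (twist g).
Proof. by rewrite /twist; slin. Qed.

Lemma twist1 g : twist g 1 = i (tr0 g).
Proof.
by rewrite /twist coprod1 (slin_pure (s := scK H)) ?antipode1 ?mul1r //; slin.
Qed.

(** Since [S(h_2 x_2) = S(x_2) S(h_2)], left [K]-linearity moves [S(x_2)] out of [tr0], next to
    [x_1], where [x_1 S(x_2)] collapses. *)
Lemma twist_incl g h x : twist g (h * i x) = counit x *: twist g h.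
Proof.
rewrite /twist (sw_mul (s := scK H)); try slin.
rewrite (slin_sum (s := scK H) (f := fun z => counit x *: z)); last slin.
apply: eq_tsumk => a b; rewrite (sw_incl i (s := scK H)); try slin.
have -> : counit x *: (a * i (tr0 (antipode b * g)))
    = \sw_(c, d <- x) (a * i (c * antipode d) * i (tr0 (antipode b * g))).
  rewrite (sw_antir (s := scK H)
    (f := fun z => a * i z * i (tr0 (antipode b * g)))); last slin.
  by rewrite rmorph1 mulr1.
apply: eq_tsumk => c d.
by rewrite antipodeM incl_antipode -[_ * _ * g]mulrA trM !rmorphM !mulrA.
Qed.

Lemma twist_sum g x :
  twist g x = \sum_j counit (tr0 (hs j * x)) *: twist g (ds j).
Proof.
have [tD _] := twist_lin g; have [_ {1}->] := db x.
rewrite (big_morph _ tD (additive0 tD)).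
by apply: eq_bigr => j _; rewrite twist_incl.
Qed.

(** A vector-valued integral identity: [twist_sum] writes [twist g] through finitely many scalar
    functionals, each of which obeys [integral_functional], and [twist g 1] is [tr0 g]. *)
Lemma integral_twist g h :
  \sw_(a, b <- h) (lam a *: twist g b) = lam h *: i (tr0 g).
Proof.
transitivity (\sum_j
    (\sw_(a, b <- h) (lam a * counit (tr0 (hs j * b)))) *: twist g (ds j)).
  transitivity (\sw_(a, b <- h) \sum_j
      (lam a * counit (tr0 (hs j * b))) *: twist g (ds j)).
    apply: eq_tsumk => a b; rewrite twist_sum scaler_sumr.
    by apply: eq_bigr => j _; rewrite scalerA.
  rewrite /tsumk /tsum exchange_big /=; apply: eq_bigr => j _.
  by rewrite scaler_suml.
rewrite -twist1 twist_sum scaler_sumr; apply: eq_bigr => j _.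
rewrite integral_functional ?scalerA //; first slin.
by move=> x y; rewrite mulrA trMr rmorphM.
Qed.

(** Insert [S(h_3) h_4] in front of [d]: then [la(h_1) h_2 tr0(S(h_3) h_4 d)] is [la(h_1)] times a
    [twist] at [h_2], and [integral_twist] reduces it to [la(h_1) tr0(h_2 d)]. *)
Lemma integral_map_trace h d : E h * i (tr0 d) = i (tr0 (E h * d)).
Proof.
rewrite /E (slin_sum (s := scK H) (f := fun z => z * _)); last slin.
rewrite (slin_sum (s := scK H) (f := fun z => i (tr0 (z * d)))); last slin.
transitivity (\sw_(a, b <- h) \sw_(u, v <- b) (lam a *: twist (v * d) u)).
  apply: eq_tsumk => a b; rewrite -scalerAl.
  rewrite -(slin_sum (s := scK H) (f := fun z => lam a *: z)); last slin.
  congr (_ *: _); rewrite -[d in LHS]mul1r.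
  rewrite (sw_insr' (s := scK H)
    (f := fun u v => u * i (tr0 (v * d)))); try slin.
  rewrite -(sw_assoc (s := scK H)
    (f := fun u v w => u * i (tr0 (antipode v * w * d)))); try slin.
  by apply: eq_tsumk => u v; apply: eq_tsumk => u1 u2; rewrite mulrA.
rewrite -(sw_assoc (s := scK H) (f := fun a u v => lam a *: twist (v * d) u));
  try by rewrite /twist; slin.
apply: eq_tsumk => a b; rewrite integral_twist.
by rewrite -scalerAl; case: trL => _ ->; rewrite linearZ.
Qed.

Definition trace_unit : H := \sum_j E (ds j) * hs j.
Local Notation u := trace_unit.

(** Expand [h] in the dual bases: [E] is right [K]-linear, and [integral_map_trace] brings
    [E (ds j)] inside [tr0]. *)
Lemma trace_unitE h : i (tr0 (u * h)) = E h.
Proof.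
have [tD _] := trL; have [ED _] := integral_map_lin la.
rewrite [h in RHS](proj2 (db h)) (big_morph _ ED (additive0 ED)).
rewrite mulr_suml (big_morph _ tD (additive0 tD)) raddf_sum.
apply: eq_bigr => j _.
by rewrite integral_mapMr integral_map_trace mulrA.
Qed.

(** Apply [tr0] to [integral_map_dual] with [E] rewritten as [tr0 (u * _)]: multiplying [g] on the
    left by this sum does not change [tr0 g], so the sum is 1 by nondegeneracy. *)
Lemma trace_unit_inv : \sw_(a, b <- La) (i (tr0 (T b)) * u * a) = 1.
Proof.
have [tD _] := trL.
apply/eqP; rewrite -subr_eq0; apply/eqP.
apply: (dual_bases_inj db) => g; rewrite mulrBl mul1r.
apply: (addIr (tr0 g)); rewrite -tD subrK add0r.
rewrite (slin_sum (s := scK H) (f := fun z => z * g)); last slin.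
rewrite (slin_sum (s := scK K) (f := tr0)); last exact: trL.
rewrite -[in RHS](integral_map_dual La_la KT TK g).
rewrite (slin_sum (s := scK K) (f := tr0)); last exact: trL.
apply: eq_tsumk => a b.
by rewrite -trace_unitE -!mulrA trM trMr.
Qed.

(** Each term of [trace_unit_inv] has [u] as a factor, whereas its total has counit 1. *)
Lemma counit_trace_unit : counit u != 0.
Proof.
apply/eqP => u0; have /eqP := congr1 counit trace_unit_inv.
rewrite (slin_sum (s := scK k^o) (f := @counit _ H)); last slin.
rewrite (_ : tsumk _ _ = 0) ?rmorph1 ?(eq_sym 0) ?oner_eq0 //.
by rewrite /tsumk /tsum big1 // => p _; rewrite !rmorphM /= u0 mulr0 mul0r.
Qed.

(** Multiplied by [g] on the right, both sides have trace [E (i x * g)], by the twisted left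
    linearity of [E]. *)
Lemma trace_unit_incl x : u * i x = i (\sw_(a, b <- x) chi a *: b) * u.
Proof.
apply/eqP; rewrite -subr_eq0; apply/eqP; have [tD _] := trL.
apply: (dual_bases_inj db) => g; apply: (@incl_inj _ _ _ i); rewrite raddf0.
rewrite mulrBl.
apply: (addIr (i (tr0 (i (\sw_(a, b <- x) chi a *: b) * u * g)))).
rewrite -rmorphD /= -tD subrK add0r -!mulrA trace_unitE trM.
rewrite rmorphM /= trace_unitE.
exact: integral_mapMl.
Qed.

(** Take counits in [trace_unit_incl] and cancel the nonzero [counit u]; what remains on the right
    is [chi(x_1) eps(x_2)]. *)
Lemma chi_counit x : chi x = counit x.
Proof.
have := congr1 counit (trace_unit_incl x).
rewrite !rmorphM /= !incl_counit mulrC => /(mulIf counit_trace_unit) ->.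
rewrite (slin_sum (s := scK k^o) (f := @counit _ K)); last slin.
rewrite -(sw_counitr (s := scK k^o) (f := chi)); last slin.
by apply: eq_tsumk => a b; rewrite !linearZ /= mulrC.
Qed.

Definition integral_trace (h : H) : K := tr0 (u * h).
Local Notation tr := integral_trace.

Lemma integral_traceE h : i (tr h) = E h.
Proof. exact: trace_unitE. Qed.

(** Once [chi] is the counit, the twist in [integral_mapMl] disappears. *)
Lemma integral_trace_bimod : bimodule_map i tr.
Proof.
split=> [g h|x y h]; first by rewrite /tr mulrDr; case: trL => ->.
apply: (@incl_inj _ _ _ i).
rewrite integral_traceE integral_mapMr !rmorphM /= integral_traceE.
congr (_ * _); rewrite (integral_mapMl chi_la); congr (i _ * _).
by rewrite -[RHS]counitl; apply: eq_tsumk => a b; rewrite chi_counit.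
Qed.

Lemma counit_integral_trace h : counit (tr h) = lam h.
Proof. by rewrite -(incl_counit i) integral_traceE counit_integral_map. Qed.

(* The second dual basis identity up to the factor [la(c S^-1(La))], which
   [integral_swapped] identifies with the counit. *)
Lemma integral_trace_swap g :
  \sw_(a, b <- La) (E (g * T b) * a) = \sw_(c, d <- g) lam (c * T La) *: d.
Proof.
pose F (a1 a2 b : H) := \sw_(c, d <- g) lam (c * T b) *: (d * (T a2 * a1)).
transitivity (\sw_(a, b <- La) \sw_(b1, b2 <- b) F a b1 b2).
  apply: eq_tsumk => a b; rewrite /E (sw_mul (s := scK H)); try slin.
  rewrite (slin_sum (s := scK H) (f := fun z => z * a)); last slin.
  rewrite [RHS]tsumk_exch; apply: eq_tsumk => c d.
  rewrite (slin_sum (s := scK H) (f := fun z => z * a)); last slin.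
  rewrite (sw_antipodeV KT TK (s := scK H)
    (f := fun p q => lam (c * p) *: (d * q) * a)); try slin.
  by apply: eq_tsumk => b1 b2; rewrite -scalerAl mulrA.
rewrite -(sw_assoc (s := scK H)); try by rewrite /F; slin.
pose G z := \sw_(c, d <- g) lam (c * T z) *: d.
rewrite -[RHS]/(G La) -(sw_counitl (s := scK H)); last by rewrite /G; slin.
apply: eq_tsumk => a b; rewrite /F [LHS]tsumk_exch; apply: eq_tsumk => c d.
rewrite -(slin_sum (s := scK H) (f := fun z => lam (c * T b) *: z)); last slin.
rewrite -(slin_sum (s := scK H) (f := fun z => d * z)); last slin.
rewrite (sw_antipodeV_mul KT TK) mulr_algr scalerA.
by case: Tl => _ ->; rewrite -scalerAr barZ linearZ /= mulrC.
Qed.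

(** Choose [h] with [lam h] nonzero. By [key] at [y = S(g_3) h], the product of the left side with
    [lam h] is [lam(g_1 S(g_2) h) = eps(g) lam(h)]. *)
Lemma integral_swapped g : lam (g * T La) = counit g.
Proof.
have [h /eqP lh] : exists h, lam h <> 0.
  by case: la_neq0 => x; case: (HbarP x) => h ->; exists h.
(* Both sides equal the sum of [lam(x S^-1(La_2)) lam(La_1 y)]: the left one by
   [integral_trace_swap], the right one by [integral_map_dual]. *)
have key x y : \sw_(c, d <- x) (lam (c * T La) * lam (d * y)) = lam (x * y).
  transitivity (lam ((\sw_(c, d <- x) lam (c * T La) *: d) * y)).
    rewrite (slin_sum (s := scK k^o) (f := fun z => lam (z * y))); last slin.
    by apply: eq_tsumk => c d; rewrite -scalerAl barZ linearZ.
  rewrite -integral_trace_swap -{2}(integral_map_dual La_la KT TK y).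
  rewrite (slin_sum (s := scK k^o) (f := fun z => lam (z * y))); last slin.
  rewrite (slin_sum (s := scK k^o) (f := fun z => lam (x * z))); last slin.
  apply: eq_tsumk => a b; rewrite -!integral_traceE -mulrA chi_la chi_counit.
  rewrite counit_integral_trace mulrA bar_incl linearZ /=.
  by rewrite counit_integral_trace mulrC.
apply: (mulIf lh).
transitivity (\sw_(a, b <- g) lam (a * (antipode b * h))).
  have := sw_insr (s := scK k^o)
    (f := fun z w => lam (z * T La) * lam (w * h)) g.
  rewrite /= mul1r => ->; try slin.
  rewrite -(sw_assoc (s := scK k^o)
    (f := fun a b c => lam (a * T La) * lam (b * antipode c * h))); try slin.
  apply: eq_tsumk => a b; rewrite -key.
  by apply: eq_tsumk => a1 a2; rewrite mulrA.
have := sw_antir (s := scK k^o) (f := fun z => lam (z * h)) g.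
rewrite mul1r => anti; apply: etrans _ (anti _); last slin.
by apply: eq_tsumk => a b; rewrite mulrA.
Qed.

Lemma integral_trace_dual_bases : exists m (hs' ds' : 'I_m -> H),
  dual_bases i tr hs' ds'.
Proof.
have [m [vs [us E1]]] := tensk_repr (coprod La).
exists m, vs, (fun j => T (us j)) => h; split.
  rewrite -[LHS]counitl.
  transitivity (\sw_(c, d <- h) lam (c * T La) *: d).
    by apply: eq_tsumk => a b; rewrite integral_swapped.
  rewrite -integral_trace_swap E1.
  by apply: eq_bigr => j _; rewrite integral_traceE.
rewrite -[LHS](integral_map_dual La_la KT TK) E1.
by apply: eq_bigr => j _; rewrite integral_traceE.
Qed.
End Integral.

(** Zorn's lemma gives a maximal subspace meeting the image of [j] trivially; it is a complement,
    and [r] projects along it. *)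
Lemma linear_retraction (k : fieldType) (V U : lmodType k)
    (j : {linear V -> U}) :
  injective j -> exists r : U -> V, slin (scK V) r /\ cancel j r.
Proof.
move=> j_inj.
pose P (A : set U) :=
  (forall c x y, A x -> A y -> A (c *: x + y)) /\ (forall v, A (j v) -> v = 0).
have [A [[A_lin A_j] A_max]] : exists A, P A /\
    forall B : set U, (A `<` B)%classic -> ~ P B.
  apply: Zorn_bigcup => F FP Ftot.
  split=> [c x y [X FX Xx] [Y FY Yy]|v [X FX Xv]].
    have [XY|YX] := Ftot _ _ FX FY.
      by exists Y => //; apply: (proj1 (FP _ FY)) => //; apply: XY.
    by exists X => //; apply: (proj1 (FP _ FX)) => //; apply: YX.
  exact: (proj2 (FP _ FX)).
(* [P] admits the empty set, the union of the empty chain, so 0 has to be adjoined to obtain a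
   subspace. *)
pose A' x := A x \/ x = 0.
have A'lin c x y : A' x -> A' y -> A' (c *: x + y).
  move=> [Ax|->] [Ay|->]; last by right; rewrite scaler0 addr0.
  - by left; apply: A_lin.
  - left; have := A_lin (c - 1) _ _ Ax Ax.
    by rewrite scalerBl scale1r subrK addr0.
  - by left; rewrite scaler0 add0r.
have A'j v : A' (j v) -> v = 0.
  by case=> [/A_j //|jv0]; apply: j_inj; rewrite linear0.
have dec u : exists v, A' (u - j v).
  apply: contrapT => nu.
  (* The span of [A'] and [u]: if [u] has no decomposition, this still satisfies [P] and is strictly
     larger than [A]. *)
  pose B x := exists c, A' (x - c *: u).
  apply: (A_max B); last split.
  - split=> [x Ax|BA]; first by exists 0; left; rewrite scale0r subr0.
    apply: nu; exists 0; left; rewrite linear0 subr0; apply: BA.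
    by exists 1; right; rewrite scale1r subrr.
  - move=> c x y [a Ax] [b Ay]; exists (c * a + b).
    have -> : c *: x + y - (c * a + b) *: u = c *: (x - a *: u) + (y - b *: u).
      by rewrite scalerBr scalerDl scalerA opprD addrACA.
    exact: A'lin.
  - move=> v [c Av]; have [c0|c0] := eqVneq c 0.
      by apply: A'j; move: Av; rewrite c0 scale0r subr0.
    case: nu; exists (c^-1 *: v).
    have := A'lin (- c^-1) _ 0 Av (or_intror erefl).
    rewrite addr0 scalerBr scalerA mulNr mulVf // scaleN1r opprK.
    by rewrite linearZ scaleNr addrC.
have uniq u v w : A' (u - j v) -> A' (u - j w) -> v = w.
  move=> uv uw; apply/eqP; rewrite -subr_eq0; apply/eqP/A'j.
  have := A'lin (-1) _ _ uv uw.
  rewrite scaleN1r opprB linearB /= addrC.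
  by rewrite [_ - j w + _]addrC addrA subrK.
have /(_ _)/cid rP u := dec u.
exists (fun u => sval (rP u)); split; last first.
  move=> v; apply: (uniq (j v)); first exact: (svalP (rP _)).
  by right; rewrite subrr.
have rlin c x y : sval (rP (c *: x + y)) = c *: sval (rP x) + sval (rP y).
  apply: uniq (svalP (rP _)) _; rewrite linearP.
  have := A'lin c _ _ (svalP (rP x)) (svalP (rP y)).
  by rewrite scalerBr addrACA opprD.
have r0 : sval (rP 0) = 0.
  by apply: (uniq 0); [apply: (svalP (rP _))|right; rewrite linear0 subrr].
split=> [x y|c x]; first by have := rlin 1 x y; rewrite !scale1r.
by have := rlin c x 0; rewrite !addr0 r0 addr0.
Qed.

(* The identity [tr(h)_1 (x) tr(h)_2 = tr(h_1) (x) h_2] holds in [K (x) H] and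
   not only in [H (x) H]; [linear_retraction] bridges the gap. *)
Definition comodule_trace (k : fieldType) (K H : hopfType k) (i : hopfExt K H)
    (tr : H -> K) : Prop :=
  forall (W : zmodType) (s : scaling k W) (f : K -> H -> W) h,
  (forall b, slin s (fun a => f a b)) -> (forall a, slin s (f a)) ->
  \sw_(a, b <- tr h) f a (i b) = \sw_(a, b <- h) f (tr a) b.

Lemma exists_comodule_trace (k : fieldType) (K H : hopfType k)
    (i : hopfExt K H) :
  frobenius_extension i -> right_integral_type i ->
  exists (tr : H -> K) (n : nat) (hs ds : 'I_n -> H),
    [/\ frobenius_morphism i tr, dual_bases i tr hs ds & comodule_trace i tr].
Proof.
move=> [fg pj [tr0 tr0F]] [la [La [chi [la_neq0 la_int La_la chi_la]]]].
have [T KT TK] := antipode_bij H.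
have [n0 [hs0 [ds0 db0]]] := frob_dual_bases tr0F fg pj.
pose tr := integral_trace la tr0 hs0 ds0.
have trE := integral_traceE la_int tr0F db0.
have [n [hs [ds db]]] :=
  integral_trace_dual_bases la_neq0 la_int La_la chi_la KT TK tr0F db0.
exists tr, n, hs, ds; split=> //.
  apply: frobenius_morphism_dual db.
  exact: (integral_trace_bimod la_int La_la chi_la KT TK tr0F db0).
move=> W s f h f1 f2.
(* Composing with [r] extends [f] from [K] to [H] in its first argument, so that the comodule
   property of [E] applies. *)
have [r [rl ir]] := linear_retraction (@incl_inj _ _ _ i).
transitivity (\sw_(a, b <- i (tr h)) f (r a) b).
  rewrite (sw_incl i (s := s)).
  - by apply: eq_tsumk => a b; rewrite ir.
  - by move=> b; apply: slin_comp (f1 b) rl.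
  - by move=> a.
rewrite trE (sw_integral_map la (s := s) (f := fun a b => f (r a) b)).
- by apply: eq_tsumk => a b; rewrite -trE ir.
- by move=> b; apply: slin_comp (f1 b) rl.
- by move=> a.
Qed.

(** * Monoidal structures on induction *)

Section Adjunction.
Variables (k : fieldType) (K H : hopfType k) (i : hopfExt K H).
Implicit Types (V U : lmodType K) (W : lmodType H).
Local Notation F V := (indm i V : lmodType H).

Lemma restr_act W x (w : restr i W) : x *: w = (i x *: (w : W) : W).
Proof. by []. Qed.

Section Lift.
Variables (V : lmodType K) (W : lmodType H) (j : {linear V -> restr i W}).

(** The transpose of [j] under the adjunction between induction and restriction. *)
Definition ind_lift_fun : indm i V -> W := tsum (fun h v => h *: (j v : W)).

Lemma ind_lift_bal :
  balanced (fun (s : H) (r : K) => s * i r) (fun r (v : V) => r *: v)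
    (fun h v => h *: (j v : W)).
Proof.
split=> [v h h'|h v v'|h x v].
- by rewrite scalerDl.
- by rewrite linearD scalerDr.
- by rewrite linearZ -scalerA.
Qed.

Lemma ind_lift_linear : linear ind_lift_fun.
Proof.
have lD : {morph ind_lift_fun : x y / x + y} by apply/tsumD/ind_lift_bal.
have lE h v : ind_lift_fun (puri i h v) = h *: (j v : W).
  exact/tsum_pure/ind_lift_bal.
move=> a x y; rewrite lD; congr (_ + _).
move: x; apply: indm_ext => [x z|x z|s v].
- by rewrite scalerDr lD.
- by rewrite lD scalerDr.
- by rewrite puriZ !lE scalerA.
Qed.

Definition ind_lift : {linear indm i V -> W} := mk_linear ind_lift_linear.

Lemma ind_liftE h v : ind_lift (puri i h v) = h *: (j v : W).
Proof. exact/tsum_pure/ind_lift_bal. Qed.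
End Lift.

(** The elements [1 (x) v] generate the induced module over [H]. On them the oplax map involves no
    Sweedler sum, so its axioms become immediate. *)
Lemma ind_ext V W (f g : {linear indm i V -> W}) :
  (forall v, f (puri i 1 v) = g (puri i 1 v)) -> f = g.
Proof.
move=> fg; apply: indm_linear_ext => h v.
by rewrite -[h]mulr1 -puriZ !linearZ fg.
Qed.

Lemma ind_tmod_ext V U W (f g : {linear indm i (tmod V U) -> W}) :
  (forall v u, f (puri i 1 (puret v u)) = g (puri i 1 (puret v u))) -> f = g.
Proof.
move=> fg; apply: ind_ext; apply: tmod_ext => // x y.
- by rewrite puriDr linearD.
- by rewrite puriDr linearD.
Qed.

Lemma ind_tmod3_ext V U V' W (f g : {linear indm i (tmod (tmod V U) V') -> W}) :
  (forall v u w, f (puri i 1 (puret (puret v u) w))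
               = g (puri i 1 (puret (puret v u) w))) -> f = g.
Proof.
move=> fg; apply: ind_tmod_ext => x w; move: x; apply: tmod_ext => // x y.
- by rewrite puretDl puriDr linearD.
- by rewrite puretDl puriDr linearD.
Qed.

Definition oplax_fun V U (v : V) (u : U) :
    restr i (tmod (F V) (F U)) :=
  puret (puri i 1 v : F V) (puri i 1 u : F U).

Lemma oplax_fun_bal V U : balancedt (@oplax_fun V U).
Proof.
have E (c : k) (X : lmodType K) (x : X) :
  puri i 1 ((c%:A : K) *: x) = (c%:A : H) *: (puri i 1 x : F X).
  by rewrite -puri_bal /= rmorph_alg puriZ mul1r mulr1.
split=> [u v v'|v u u'|v c u]; rewrite /oplax_fun ?puriDr ?puretDl ?puretDr //.
by rewrite !E puret_bal.
Qed.

Lemma oplax_fun_lin V U x v u :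
  tsumk (fun a b => @oplax_fun V U (a *: v) (b *: u)) (coprod x)
  = x *: oplax_fun v u.
Proof.
rewrite restr_act /oplax_fun puretZ (sw_incl i (s := scM _)); try slin.
by apply: eq_tsumk => a b; rewrite !puriZ !mulr1 -!puri_bal !mul1r.
Qed.

Definition ind_oplax V U :
    {linear indm i (tmod V U) -> tmod (F V) (F U)} :=
  ind_lift (tmod_lift (@oplax_fun_bal V U) (@oplax_fun_lin V U)).

Lemma ind_oplaxE V U h (v : V) (u : U) :
  ind_oplax V U (puri i h (puret v u))
  = \sw_(a, b <- h) puret (puri i a v : F V) (puri i b u : F U).
Proof.
rewrite ind_liftE tmod_liftE puretZ.
by apply: eq_tsumk => a b; rewrite !puriZ !mulr1.
Qed.

Lemma ind_oplax1 V U (v : V) (u : U) :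
  ind_oplax V U (puri i 1 (puret v u))
  = puret (puri i 1 v : F V) (puri i 1 u : F U).
Proof. by rewrite ind_liftE tmod_liftE scale1r. Qed.

Lemma oplax0_linear :
  linear (fun x : unitm K => unit_el H x : restr i (unitm H)).
Proof.
move=> x c d; rewrite restr_act !unitmZ incl_counit.
by [].
Qed.

Definition ind_oplax0 : {linear indm i (unitm K) -> unitm H} :=
  ind_lift (mk_linear oplax0_linear).

Lemma ind_oplax0E h c :
  ind_oplax0 (puri i h (unit_el K c)) = unit_el H (counit h * c).
Proof. by rewrite ind_liftE. Qed.

Lemma ind_oplax_nat V V' U U' (f : {linear V -> V'}) (g : {linear U -> U'}) :
  lcomp (ind_oplax V' U') (indm_hom i (tmod_hom f g))
  = lcomp (tmod_hom (indm_hom i f) (indm_hom i g)) (ind_oplax V U).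
Proof.
apply: ind_tmod_ext => v u.
by rewrite !lcompE ind_oplax1 tmod_homE !indm_homE tmod_homE ind_oplax1.
Qed.

Lemma ind_oplax_asc V U X :
  lcomp
    (lcomp (mod_asc (F V) (F U) (F X)) (tmod_hom (ind_oplax V U) (lid (F X))))
    (ind_oplax (tmod V U) X)
  = lcomp
      (lcomp (tmod_hom (lid (F V)) (ind_oplax U X)) (ind_oplax V (tmod U X)))
      (indm_hom i (mod_asc V U X)).
Proof.
apply: ind_tmod3_ext => v u x.
rewrite !lcompE indm_homE mod_ascE !ind_oplax1 !tmod_homE !ind_oplax1.
by rewrite mod_ascE.
Qed.

Lemma puri1_scale V c (v : V) :
  puri i 1 ((c%:A : K) *: v) = (c%:A : H) *: (puri i 1 v : F V).
Proof. by rewrite -puri_bal /= rmorph_alg puriZ mul1r mulr1. Qed.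

Lemma ind_oplax_lun V :
  lcomp (lcomp (mod_lun (F V)) (tmod_hom ind_oplax0 (lid (F V))))
    (ind_oplax (unitm K) V)
  = indm_hom i (mod_lun V).
Proof.
apply: ind_tmod_ext => c v.
rewrite !lcompE indm_homE ind_oplax1 tmod_homE ind_oplax0E.
by rewrite !mod_lunE puri1_scale rmorph1 mul1r.
Qed.

Lemma ind_oplax_run V :
  lcomp (lcomp (mod_run (F V)) (tmod_hom (lid (F V)) ind_oplax0))
    (ind_oplax V (unitm K))
  = indm_hom i (mod_run V).
Proof.
apply: ind_tmod_ext => v c.
rewrite !lcompE indm_homE ind_oplax1 tmod_homE ind_oplax0E.
by rewrite !mod_runE puri1_scale rmorph1 mul1r.
Qed.

Definition ind_oplax_structure : oplax_structure (IndH i) :=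
  @Oplax (HMod K) (HMod H) (IndH i) (fun V U => ind_oplax V U) ind_oplax0
    ind_oplax_nat ind_oplax_asc ind_oplax_lun ind_oplax_run.

Lemma ind_oplax_formula : oplax_formula ind_oplax_structure.
Proof.
split=> [V U h v u|h]; first exact: ind_oplaxE.
by rewrite ind_oplax0E mulr1.
Qed.
End Adjunction.

(** * The lax structure: induction as right adjoint of restriction *)

Section Lax.
Variables (k : fieldType) (K H : hopfType k) (i : hopfExt K H).
Variables (tr : H -> K) (n : nat) (hs ds : 'I_n -> H).
Hypotheses (trF : frobenius_morphism i tr) (db : dual_bases i tr hs ds).
Implicit Types (V U : lmodType K) (W : lmodType H).
Local Notation F V := (indm i V : lmodType H).
Let trL := frob_lin trF.

Section Trace.
Variable V : lmodType K.

(** The counit of the adjunction that makes induction right adjoint to restriction; [coind_lift] is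
    the corresponding transpose. *)
Definition ev_fun : restr i (F V) -> V := tsum (fun h v => tr h *: v).

Lemma ev_bal :
  balanced (fun (s : H) (r : K) => s * i r) (fun r (v : V) => r *: v)
    (fun h v => tr h *: v).
Proof.
split=> [v h h'|h v v'|h x v]; rewrite ?scalerDr //.
  by case: trL => -> _; rewrite scalerDl.
by rewrite (frobMr trF) scalerA.
Qed.

Lemma ev_funE h v : ev_fun (puri i h v) = tr h *: v.
Proof. exact/tsum_pure/ev_bal. Qed.

Lemma ev_funD : {morph ev_fun : x y / x + y}.
Proof. exact/tsumD/ev_bal. Qed.

Lemma ev_linear : linear ev_fun.
Proof.
move=> a x y; rewrite ev_funD; congr (_ + _); rewrite restr_act.
move: x; apply: indm_ext => [x z|x z|s v].
- by rewrite scalerDr ev_funD.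
- by rewrite ev_funD scalerDr.
- by rewrite puriZ !ev_funE (frobMl trF) scalerA.
Qed.

Definition ev : {linear restr i (F V) -> V} := mk_linear ev_linear.

Lemma evE h v : ev (puri i h v) = tr h *: v.
Proof. exact: ev_funE. Qed.

Lemma evD (p q : F V) : ev (p + q : F V) = ev p + ev q.
Proof. exact: ev_funD. Qed.

Lemma ev_act x (p : F V) : ev (i x *: p : F V) = x *: ev p.
Proof. by rewrite -[i x *: p]/(x *: (p : restr i (F V))) linearZ. Qed.

(** The second dual basis identity tensored with [V]; it shows that [p] is determined by the values
    of [ev] on its multiples. *)
Lemma ind_expand (p : F V) : p = \sum_j puri i (ds j) (ev (hs j *: p : F V)).
Proof.
move: p; apply: indm_ext => [//|x y|h v].
  rewrite -big_split; apply: eq_bigr => j _.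
  by rewrite scalerDr evD puriDr.
rewrite {1}(proj2 (db h)) (big_morph _ (puriDl i v) (additive0 (puriDl i v))).
by apply: eq_bigr => j _; rewrite puriZ evE -puri_bal.
Qed.

Lemma ev_inj (p q : F V) :
  (forall h, ev (h *: p : F V) = ev (h *: q : F V)) -> p = q.
Proof.
move=> pq; rewrite [p]ind_expand [q]ind_expand.
by apply: eq_bigr => j _; rewrite pq.
Qed.
End Trace.

Section Lift.
Variables (W : lmodType H) (V : lmodType K) (f : {linear restr i W -> V}).

Definition coind_lift_fun (w : W) : indm i V := 
  \sum_j puri i (ds j) (f (hs j *: w : W)).

Lemma ev_coind_fun h w : ev V (h *: coind_lift_fun w : F V) = f (h *: w : W).
Proof.
rewrite [in RHS](proj1 (db h)) scaler_suml scaler_sumr.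
rewrite (big_morph (fun w : W => f w) (raddfD f) (raddf0 f)).
rewrite (big_morph (fun w : F V => ev V w) (raddfD (ev V)) (raddf0 (ev V))).
apply: eq_bigr => j _; rewrite puriZ evE -scalerA.
by rewrite -[i _ *: _]/(tr (h * ds j) *: (hs j *: w : restr i W)) linearZ.
Qed.

(** By [ev_inj] the equation can be tested after acting by any [h] and applying [ev], where it is
    additivity of [f]. *)
Lemma coind_lift_linear : linear coind_lift_fun.
Proof.
move=> x w w'; apply: ev_inj => h; rewrite ev_coind_fun !scalerDr scalerA.
have fD (a b : W) : f (a + b : W) = f a + f b by apply: raddfD.
by rewrite fD evD scalerA !ev_coind_fun.
Qed.

Definition coind_lift : {linear W -> indm i V} := mk_linear coind_lift_linear.

Lemma ev_coind w : ev V (coind_lift w) = f w.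
Proof.
rewrite -[coind_lift w]scale1r -[in RHS](scale1r w).
exact: ev_coind_fun.
Qed.
End Lift.

(** Uniqueness of transposes. The lax axioms are equations between maps into induced modules, so
    applying [ev] reduces them to identities between [K]-modules. *)
Lemma coind_ext W V (f g : {linear W -> indm i V}) :
  (forall w, ev V (f w) = ev V (g w)) -> f = g.
Proof.
by move=> fg; apply: linear_ext => w; apply: ev_inj => h; rewrite -!linearZ fg.
Qed.

Lemma ev_nat V V' (f : {linear V -> V'}) (p : F V) :
  ev V' (indm_hom i f p) = f (ev V p).
Proof.
move: p; apply: indm_ext => [x y|x y|h v].
- by rewrite linearD evD.
- by rewrite evD linearD.
- by rewrite indm_homE !evE linearZ.
Qed.

Definition ev2_fun V U (p : F V) (q : F U) : tmod V U :=
  puret (ev V p) (ev U q).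

Lemma evZ V (c : k) (p : F V) :
  ev V ((c%:A : H) *: p : F V) = (c%:A : K) *: ev V p.
Proof. by rewrite -ev_act /= rmorph_alg. Qed.

Lemma ev2_bal V U : balancedt (V := F V) (U := F U) (@ev2_fun V U).
Proof.
split=> [q p p'|p q q'|p c q]; rewrite /ev2_fun ?evD ?puretDl ?puretDr //.
by rewrite !evZ puret_bal.
Qed.

Definition ev2_map V U : restr i (tmod (F V) (F U)) -> tmod V U :=
  tsumt (V := F V) (U := F U) (@ev2_fun V U).

Lemma ev2_mapD V U : {morph @ev2_map V U : x y / x + y}.
Proof. exact/tsumD/ev2_bal. Qed.

Lemma ev2_mapE V U (p : F V) (q : F U) :
  ev2_map (puret p q) = puret (ev V p) (ev U q).
Proof. exact/tsum_pure/ev2_bal. Qed.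

Lemma ev2_linear V U : linear (@ev2_map V U).
Proof.
have tD := @ev2_mapD V U; have tE := @ev2_mapE V U.
move=> x t t'; rewrite tD; congr (_ + _); rewrite restr_act.
move: t; apply: tmod_ext => [y z|y z|p q].
- by rewrite scalerDr tD.
- by rewrite tD scalerDr.
rewrite puretZ (additive_sum _ _ tD) (sw_incl i (s := scM _)); last 2 first.
- move=> b; split=> [a a'|r a]; rewrite !tE ?scalerDl ?evD ?puretDl //.
  by rewrite algZl evZ -puretZk.
- move=> a; split=> [b b'|r b]; rewrite !tE ?scalerDl ?evD ?puretDr //.
  by rewrite algZl evZ -puret_bal -puretZk.
rewrite tE puretZ; apply: eq_tsumk => a b.
by rewrite tE !ev_act.
Qed.

Definition ev2 V U : {linear restr i (tmod (F V) (F U)) -> tmod V U} :=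
  mk_linear (@ev2_linear V U).

Lemma ev2E V U (p : F V) (q : F U) :
  ev2 V U (puret p q) = puret (ev V p) (ev U q).
Proof. exact: ev2_mapE. Qed.

Definition ind_lax V U : {linear tmod (F V) (F U) -> indm i (tmod V U)} :=
  coind_lift (ev2 V U).

Lemma ev_lax V U (p : F V) (q : F U) :
  ev (tmod V U) (ind_lax V U (puret p q)) = puret (ev V p) (ev U q).
Proof. by rewrite ev_coind ev2E. Qed.

Lemma lax0_linear : linear (fun x : restr i (unitm H) => unit_el K x).
Proof. by move=> x c d; rewrite restr_act !unitmZ incl_counit. Qed.

Definition ind_lax0 : {linear unitm H -> indm i (unitm K)} :=
  coind_lift (mk_linear lax0_linear).

Lemma ev_lax0 c : ev (unitm K) (ind_lax0 (unit_el H c)) = unit_el K c.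
Proof. by rewrite ev_coind. Qed.

Lemma coind_tmod_ext W W' V (f g : {linear tmod W W' -> indm i V}) :
  (forall w w', ev V (f (puret w w')) = ev V (g (puret w w'))) -> f = g.
Proof.
move=> fg; apply: coind_ext; apply: tmod_ext => // x y.
- by rewrite linearD evD.
- by rewrite linearD evD.
Qed.

Lemma coind_tmod3_ext W W' W2 V
    (f g : {linear tmod (tmod W W') W2 -> indm i V}) :
  (forall w w' w2, ev V (f (puret (puret w w') w2))
                 = ev V (g (puret (puret w w') w2))) -> f = g.
Proof.
move=> fg; apply: coind_tmod_ext => x w; move: x; apply: tmod_ext => // x y.
- by rewrite puretDl linearD evD.
- by rewrite puretDl linearD evD.
Qed.

Lemma ind_lax_nat V V' U U' (f : {linear V -> V'}) (g : {linear U -> U'}) :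
  lcomp (ind_lax V' U') (tmod_hom (indm_hom i f) (indm_hom i g))
  = lcomp (indm_hom i (tmod_hom f g)) (ind_lax V U).
Proof.
apply: coind_tmod_ext => p q.
by rewrite !lcompE tmod_homE ev_nat !ev_lax tmod_homE !ev_nat.
Qed.

Lemma ind_lax_asc V U X :
  lcomp (lcomp (indm_hom i (mod_asc V U X)) (ind_lax (tmod V U) X))
    (tmod_hom (ind_lax V U) (lid (F X)))
  = lcomp (lcomp (ind_lax V (tmod U X)) (tmod_hom (lid (F V)) (ind_lax U X)))
    (mod_asc (F V) (F U) (F X)).
Proof.
apply: coind_tmod3_ext => p q r.
rewrite !lcompE mod_ascE !tmod_homE ev_nat !ev_lax !lidE.
by rewrite mod_ascE.
Qed.

Lemma ind_lax_lun V :
  lcomp (lcomp (indm_hom i (mod_lun V)) (ind_lax (unitm K) V))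
    (tmod_hom ind_lax0 (lid (F V)))
  = mod_lun (F V).
Proof.
apply: coind_tmod_ext => c p.
by rewrite !lcompE tmod_homE ev_nat ev_lax ev_lax0 !mod_lunE evZ.
Qed.

Lemma ind_lax_run V :
  lcomp (lcomp (indm_hom i (mod_run V)) (ind_lax V (unitm K)))
    (tmod_hom (lid (F V)) ind_lax0)
  = mod_run (F V).
Proof.
apply: coind_tmod_ext => p c.
by rewrite !lcompE tmod_homE ev_nat ev_lax ev_lax0 !mod_runE evZ.
Qed.

Definition ind_lax_structure : lax_structure (IndH i) :=
  @Lax (HMod K) (HMod H) (IndH i) (fun V U => ind_lax V U) ind_lax0
    ind_lax_nat ind_lax_asc ind_lax_lun ind_lax_run.

Lemma ind_lax_formula : lax_formula tr hs ds ind_lax_structure.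
Proof.
split=> [V U h g v u|]; apply: eq_bigr => j _.
  congr (puri _ _ _); rewrite puretZ.
  rewrite -[LHS]/(ev2_map _) (additive_sum _ _ (@ev2_mapD V U)).
  by apply: eq_tsumk => a b; rewrite ev2_mapE !puriZ !evE.
by congr (puri _ _ _); rewrite -[LHS]/(unit_el K (counit (hs j) * 1)) mulr1.
Qed.
End Lax.

Lemma linear_tsumk (k : fieldType) (A B : lmodType k) (R : pzRingType)
    (V W : lmodType R) (f : {linear V -> W}) (g : A -> B -> V) t :
  f (tsumk g t) = tsumk (fun a b => f (g a b)) t.
Proof. by apply: additive_sum => x y; rewrite linearD. Qed.

(** * The Frobenius identities *)

Section FrobeniusMonoidal.
Variables (k : fieldType) (K H : hopfType k) (i : hopfExt K H).
Variables (tr : H -> K) (n : nat) (hs ds : 'I_n -> H).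
Hypotheses (trF : frobenius_morphism i tr) (db : dual_bases i tr hs ds).
Hypothesis trC : comodule_trace i tr.
Implicit Types (V U X : lmodType K) (W : lmodType H).
Local Notation F V := (indm i V : lmodType H).
Let trL := frob_lin trF.
Local Notation lax := (ind_lax trF db).

(* [(h (x) v) (x) w = sum h_1 ((1 (x) v) (x) S(h_2) w)]. *)
Lemma proj_ext V W W' (f g : {linear tmod (F V) W -> W'}) :
  (forall v w, f (puret (puri i 1 v : F V) w)
             = g (puret (puri i 1 v : F V) w)) ->
  f = g.
Proof.
move=> fg; apply/linear_ext/tmod_ext => [x y|x y|p w]; rewrite ?linearD //.
move: p; apply: indm_ext => [x y|x y|h v]; rewrite ?puretDl ?linearD //.
have -> : puret (puri i h v : F V) w
    = \sw_(a, b <- h) (a *: puret (puri i 1 v : F V) (antipode b *: w)).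
  rewrite -[w in LHS]scale1r.
  rewrite (sw_insr (s := scM _)
    (f := fun a b => puret (puri i a v : F V) (b *: w))); try slin.
  rewrite -(sw_assoc (s := scM _) (f := fun a b c =>
    puret (puri i a v : F V) ((b * antipode c) *: w))); try slin.
  apply: eq_tsumk => a b; rewrite puretZ.
  by apply: eq_tsumk => a1 a2; rewrite puriZ mulr1 scalerA.
rewrite !linear_tsumk.
by apply: eq_tsumk => a b; rewrite !linearZ fg.
Qed.

Lemma slin_ev V (q : F V) : slin (scM V) (fun b : H => ev trF V (b *: q : F V)).
Proof.
split=> [a b|r b]; first by rewrite scalerDl evD.
by rewrite algZl evZ.
Qed.

(** The left side is the sum of [d_j (x) (tr(h_j1) v (x) ev(h_j2 q))]. The comodule property
    replaces the legs by those of [tr(h_j)]; this element of [K] moves across the tensor sign, and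
    the [d_j tr(h_j)] add up to 1. *)
Lemma ind_lax1 V U (v : V) (q : F U) :
  lax V U (puret (puri i 1 v : F V) q) = puri i 1 (puret v (ev trF U q)).
Proof.
rewrite [1 in RHS](proj2 (db 1)).
rewrite (big_morph _ (puriDl i _) (additive0 (puriDl i _))).
apply: eq_bigr => j _; rewrite mulr1 puri_bal; congr (puri _ _ _).
rewrite !puretZ -[LHS]/(ev2_map trF _).
rewrite (additive_sum _ _ (@ev2_mapD _ _ _ _ _ trF V U)).
pose f (a : K) (b : H) := puret (a *: v) (ev trF U (b *: q : F U)).
transitivity (\sw_(a, b <- hs j) f (tr a) b).
  by apply: eq_tsumk => a b; rewrite ev2_mapE puriZ mulr1 evE.
rewrite -(trC (s := scM _)).
- by apply: eq_tsumk => a b; rewrite /f ev_act.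
- by move=> b; rewrite /f; slin.
- by move=> a; apply/slin_puretr/slin_ev.
Qed.

(** On [(1 (x) (v (x) u)) (x) q] both sides give [(1 (x) v) (x) (1 (x) (u (x) ev q))]. *)
Lemma ind_frobenius_l V U X :
  lcomp (lcomp (tmod_hom (lid (F V)) (lax U X)) (mod_asc (F V) (F U) (F X)))
    (tmod_hom (ind_oplax i V U) (lid (F X)))
  = lcomp (lcomp (ind_oplax i V (tmod U X)) (indm_hom i (mod_asc V U X)))
      (lax (tmod V U) X).
Proof.
apply: proj_ext => t q; move: t; apply: tmod_ext => [x y|x y|v u].
- by rewrite puriDr puretDl linearD.
- by rewrite puriDr puretDl linearD.
rewrite !lcompE tmod_homE ind_lax1 indm_homE mod_ascE !ind_oplax1 !lidE.
by rewrite mod_ascE tmod_homE ind_lax1.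
Qed.

(** On [(1 (x) v) (x) (g (x) (u (x) x))] the left side has the legs [tr(g_1)] and [g_2], the right
    side those of the coproduct of [tr g]; the comodule property identifies them. *)
Lemma ind_frobenius_r V U X :
  lcomp (lcomp (tmod_hom (lax V U) (lid (F X))) (mod_ascV (F V) (F U) (F X)))
    (tmod_hom (lid (F V)) (ind_oplax i U X))
  = lcomp (lcomp (ind_oplax i (tmod V U) X) (indm_hom i (mod_ascV V U X)))
      (lax V (tmod U X)).
Proof.
apply: proj_ext => v q; move: q; apply: indm_ext => [x y|x y|g t].
- by rewrite puretDr linearD.
- by rewrite puretDr linearD.
move: t; apply: tmod_ext => [x y|x y|u x].
- by rewrite puriDr puretDr linearD.
- by rewrite puriDr puretDr linearD.
rewrite !lcompE tmod_homE ind_lax1 indm_homE ind_oplaxE !lidE evE puretZ.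
rewrite !puret_tsumkr !linear_tsumk (additive_sum _ _ (puriDr i 1)).
rewrite linear_tsumk.
pose f (a : K) (b : H) :=
  puret (puri i 1 (puret v (a *: u)) : F (tmod V U)) (puri i b x : F X).
transitivity (\sw_(a, b <- g) f (tr a) b).
  apply: eq_tsumk => a b.
  by rewrite mod_ascVE tmod_homE ind_lax1 lidE evE.
rewrite -(trC (s := scM _)).
- apply: eq_tsumk => a b.
  by rewrite mod_ascVE ind_oplax1 -(puri_bal i 1 b x) mul1r.
- by move=> b; rewrite /f; slin.
- by move=> a; rewrite /f; slin.
Qed.

Definition ind_frobenius : frobenius_monoidal (IndH i) :=
  @FrobeniusMonoidal (HMod K) (HMod H) (IndH i) (ind_lax_structure trF db)
    (ind_oplax_structure i) ind_frobenius_r ind_frobenius_l.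
End FrobeniusMonoidal.

(** * Finite dimension *)

(* A surjection from ['rV_m] with [m] minimal is bijective. *)
Lemma vector_axiom_surj (k : fieldType) (V : lmodType k) n
    (f : {linear 'rV[k]_n -> V}) :
  (forall x, exists r, f r = x) -> exists m, inhabited (Vector.axiom m V).
Proof.
move=> f_surj.
pose P m :=
  `[< exists g : {linear 'rV[k]_m -> V}, forall x, exists r, g r = x >].
have exP : exists m, P m by exists n; apply/asboolP; exists f.
case: (ex_minnP exP) => m /asboolP[g g_surj] m_min.
have g_inj : injective g.
  apply: raddf_inj => r gr0; apply/eqP; apply: contraT => r_neq0.
  have [j rj] : exists j, r 0 j != 0.
    apply/existsP; apply: contraR r_neq0; rewrite negb_exists => /forallP r0.
    by apply/eqP/rowP => j; rewrite mxE; apply/eqP; move: (r0 j); rewrite negbK.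
  case: m => [|m] in g r j g_surj m_min gr0 r_neq0 rj *; first by case: j rj.
  have : P m.
    apply/asboolP.
    (* [M] embeds the rows of length [m] as those with vanishing coordinate [j]. The composite with
       [g] stays surjective: subtracting a multiple of the kernel vector [r] clears that coordinate
       without changing the image. *)
    pose M : 'M[k]_(m, m.+1) := \matrix_(a, b) (b == lift j a)%:R.
    pose h : {linear 'rV[k]_m -> V} := g \o mulmxr M.
    exists h => x; have [y gy] := g_surj x.
    pose z := y - (y 0 j / r 0 j) *: r.
    exists (\row_a z 0 (lift j a)).
    rewrite /h /= (_ : _ *m M = z).
      by rewrite linearB linearZ /= gr0 scaler0 subr0.
    apply/rowP => b; rewrite mxE.
    case: (unliftP j b) => [a ->|->].
      rewrite (bigD1 a) //= big1 ?addr0 => [|a' a'a].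
        by rewrite !mxE eqxx mulr1.
      by rewrite !mxE (inj_eq lift_inj) eq_sym (negPf a'a) mulr0.
    rewrite big1 => [|a _]; first by rewrite !mxE divfK // subrr.
    by rewrite !mxE (negPf (neq_lift _ _)) mulr0.
  by move/m_min; rewrite ltnn.
have /(_ _)/cid gP x := g_surj x.
have gK : cancel (fun x => sval (gP x)) g by move=> x; apply: svalP (gP x).
have Kg : cancel g (fun x => sval (gP x)) by move=> r; apply: g_inj; rewrite gK.
exists m; constructor; exists (fun x => sval (gP x)); last by exists g.
by move=> c x y; apply: g_inj; rewrite linearP !gK.
Qed.

(** By [ind_expand] the induced module is spanned over [k] by the [ds j] tensored with a basis of
    [V]; an [n] by [m] matrix holds the coefficients. *)
Lemma ind_finite_dimensional (k : fieldType) (K H : hopfType k)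
    (i : hopfExt K H) (tr : H -> K) n (hs ds : 'I_n -> H) (V : lmodType K) :
  frobenius_morphism i tr -> dual_bases i tr hs ds ->
  finite_dimensional V -> finite_dimensional (indm i V : lmodType H).
Proof.
move=> trF db [m [[v2r v2r_lin [r2v v2rK r2vK]]]].
pose F : lmodType H := indm i V.
pose g (A : 'M[k]_(n, m)) : restr (in_alg H) F :=
  \sum_j puri i (ds j) (r2v (row j A) : V).
have r2vP c x y : r2v (c *: x + y) = (c%:A : K) *: (r2v x : V) + r2v y.
  by apply: (can_inj v2rK); rewrite v2r_lin !r2vK.
have g_lin : linear g.
  move=> c A B; rewrite scaler_sumr -big_split; apply: eq_bigr => j _ /=.
  rewrite linearP r2vP puriDr -puri_bal /= rmorph_alg; congr (_ + _).
  by rewrite restrZ puriZ /= mulr_algl mulr_algr.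
pose f : {linear 'rV[k]_(n * m) -> restr (in_alg H) F} :=
  mk_linear g_lin \o vec_mx.
apply: (vector_axiom_surj (f := f)) => p.
pose q j : V := ev trF V (hs j *: (p : F) : F).
exists (mxvec (\matrix_(j, a) v2r (q j) 0 a)).
rewrite /f /= mxvecK /g [RHS](ind_expand trF db); apply: eq_bigr => j _.
congr (puri _ _ _); apply: (can_inj v2rK); rewrite r2vK.
by apply/rowP => a; rewrite !mxE.
Qed.

Theorem theorem4p2 (k : fieldType) (K H : hopfType k) (i : hopfExt K H)
    (hF : frobenius_extension i) (hI : right_integral_type i) :
  (exists (tr : H -> K) (n : nat) (hs ds : 'I_n -> H),
    [/\ frobenius_morphism i tr,
        dual_bases i tr hs ds &
        exists F : frobenius_monoidal (IndH i),
          lax_formula tr hs ds F /\ oplax_formula F]) /\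
  restricts (IndH i) (@finite_dimensional k K) (@finite_dimensional k H).
Proof.
have [tr [n [hs [ds [trF db trC]]]]] := exists_comodule_trace hF hI.
split; last first.
  by apply: restrictsP => V; apply: ind_finite_dimensional trF db.
exists tr, n, hs, ds; split=> //.
exists (ind_frobenius trF db trC); split; first exact: ind_lax_formula.
exact: ind_oplax_formula.
Qed.
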